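(* Let $(M,\varphi_i,\xi_i,\eta_i,g)$, $i=1,2,3$, be a canonical almost $3$-contact metric manifold of dimension $4n+3$, $n\ge1$. Its canonical connection $\nabla$ leaves the associated bundle of endomorphisms $\Upsilon_M$ (the rank-$3$ bundle spanned by $\varphi_1,\varphi_2,\varphi_3$) invariant, and it satisfies $$\nabla\Psi=0,\qquad \nabla(\eta_1\wedge\eta_2\wedge\eta_3)=0,$$ where $\Psi=\Phi_1\wedge\Phi_1+\Phi_2\wedge\Phi_2+\Phi_3\wedge\Phi_3$. In particular, its holonomy algebra $\mathfrak{hol}(\nabla)$ is contained in $(\mathfrak{sp}(n)\oplus\mathfrak{sp}(1))\oplus\mathfrak{so}(3)\subset\mathfrak{so}(4n)\oplus\mathfrak{so}(3)$.
   Context: An almost contact metric structure $(\varphi,\xi,\eta,g)$ consists of a $(1,1)$-tensor field $\varphi$, a vector field $\xi$, a $1$-form $\eta$ and a Riemannian metric $g$ with $\varphi^2=-I+\eta\otimes\xi$, $\eta(\xi)=1$, $g(\varphi X,\varphi Y)=g(X,Y)-\eta(X)\eta(Y)$. Its fundamental form is $\Phi(X,Y)=g(X,\varphi Y)$, and $N_\varphi(X,Y)=[\varphi X,\varphi Y]+\varphi^2[X,Y]-\varphi[\varphi X,Y]-\varphi[X,\varphi Y]+d\eta(X,Y)\xi$, $N_\varphi(X,Y,Z)=g(N_\varphi(X,Y),Z)$. An almost $3$-contact metric manifold $(M,\varphi_i,\xi_i,\eta_i,g)$, $i=1,2,3$, is a manifold of dimension $4n+3$ with three almost contact metric structures with the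 same $g$ such that, for every even permutation $(i,j,k)$ of $(1,2,3)$, $\varphi_k=\varphi_i\varphi_j-\eta_j\otimes\xi_i=-\varphi_j\varphi_i+\eta_i\otimes\xi_j$, $\xi_k=\varphi_i\xi_j=-\varphi_j\xi_i$, $\eta_k=\eta_i\circ\varphi_j=-\eta_j\circ\varphi_i$. Set $\mathcal H=\bigcap_i\ker\eta_i$ (rank $4n$) and $\mathcal V=\langle\xi_1,\xi_2,\xi_3\rangle$; the subalgebra $\mathfrak{so}(4n)\oplus\mathfrak{so}(3)$ is the one acting on $TM=\mathcal H\oplus\mathcal V$, and $\mathfrak{sp}(n)\oplus\mathfrak{sp}(1)$ acts on $\mathcal H$ in the standard quaternionic way with $\mathfrak{sp}(1)$ spanned by the $\varphi_i|_{\mathcal H}$. For $X,Y\in\Gamma(\mathcal H)$ let $A_{ij}(X,Y)=g((\mathcal L_{\xi_j}\varphi_i)X,Y)+d\eta_j(X,\varphi_iY)+d\eta_j(\varphi_iX,Y)$, $A_i=A_{ii}$. $M$ admits a Reeb Killing function $\beta\in C^\infty(M)$ if $A_i(X,Y)=0$ and $A_{ij}(X,Y)=-A_{ji}(X,Y)=\beta\Phi_k(X,Y)$ for all $X,Y\in\Gamma(\mathcal H)$ and every even permutation $(i,j,k)$ of $(1,2,3)$. $M$ is canonical if: 1) each $N_{\varphi_i}$ is skew-symmetric on $\mathcal H$ (i.e. $N_{\varphi_i}(X,Y,Z)$ restricted to $\mathcal H$ is a $3$-form); 2) each $\xi_i$ is Killing; 3) $N_{\varphi_i}(X,Y,Z)-d\Phi_i(\varphi_iX,\varphi_iY,\varphi_iZ)=N_{\varphi_j}(X,Y,Z)-d\Phi_j(\varphi_jX,\varphi_jY,\varphi_jZ)$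 for all $X,Y,Z\in\Gamma(\mathcal H)$ and all $i,j$; 4) $M$ admits a Reeb Killing function $\beta$. A metric connection has skew torsion if $T(X,Y,Z)=g(T(X,Y),Z)$ is a $3$-form. The canonical connection of a canonical manifold is the unique metric connection $\nabla$ with skew torsion such that $\nabla_X\varphi_i=\beta(\eta_k(X)\varphi_j-\eta_j(X)\varphi_k)$ for all $X$ and every even permutation $(i,j,k)$ of $(1,2,3)$, $\beta$ being the Reeb Killing function. Conventions: $d\eta(X,Y)=X(\eta(Y))-Y(\eta(X))-\eta([X,Y])$, and analogously (no numerical factors) in higher degree. *)

(* Defs.v *)
From HB Require Import structures.
From mathcomp Require Import all_boot all_order all_algebra all_fingroup.
From mathcomp Require Import all_classical all_reals all_analysis.
Set Implicit Arguments.
Unset Strict Implicit.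
Unset Printing Implicit Defensive.
Import Order.TTheory GRing.Theory Num.Theory.
Import numFieldNormedType.Exports.
Local Open Scope classical_set_scope.
Local Open Scope ring_scope.

Section EuclideanSmoothness.
Variables (R : realType) (E : normedModType R).

Fixpoint times_differentiable (k : nat) (U : set E) (f : E -> R) : Prop :=
  if k is k'.+1 then
    (forall x, U x -> differentiable f x) /\
    (forall v, times_differentiable k' U ('D_v f))
  else True.

(* C^oo on the open set U; the values of f outside U are irrelevant. *)
Definition smooth_on (U : set E) (f : E -> R) : Prop :=
  forall k, times_differentiable k U f.

End EuclideanSmoothness.

(* A smooth manifold of dimension m, given by a smooth atlas.  The inverse
   charts are total functions, meaningful on the image of the chart only.  The
   choice of one chart around every point serves to represent the tangent space
   at p by column vectors (see [tangent]). *)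
Record manifold (R : realType) (m : nat) := Manifold {
  points :> topologicalType;
  chart : Type;
  cdom : chart -> set points;
  cmap : chart -> points -> 'cV[R]_m;
  cinv : chart -> 'cV[R]_m -> points;
  chart_at : points -> chart;
  manifold_hausdorff : hausdorff_space points;
  manifold_second_countable : @second_countable points;
  cdom_open : forall c, open (cdom c);
  crange_open : forall c, open (cmap c @` cdom c);
  cmapK : forall c p, cdom c p -> cinv c (cmap c p) = p;
  cmap_continuous : forall c p, cdom c p -> {for p, continuous (cmap c)};
  cinv_continuous : forall c x, (cmap c @` cdom c) x ->
    {for x, continuous (cinv c)};
  transition_smooth : forall c d (k : 'I_m),
    smooth_on (cmap c @` (cdom c `&` cdom d))
      (fun x => cmap d (cinv c x) k 0);
  cdom_chart_at : forall p, cdom (chart_at p) p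
}.

Arguments cmap {R m M} : rename.
Arguments cinv {R m M} : rename.
Arguments cdom {R m M} : rename.
Arguments chart_at {R m M} : rename.

Section Calculus.
Variables (R : realType) (m : nat) (M : manifold R m).
Implicit Types (p : M) (c : chart M) (U : set M).

(* The tangent vector at p whose components in the chart [chart_at p] are v is
   represented by v; accordingly covectors at p are row vectors, and
   endomorphisms and bilinear forms of the tangent space at p are square
   matrices. *)
Definition tangent (p : M) := 'cV[R]_m.

(* Vector fields and functions are total functions, but only their restriction
   to an open set U matters; identities between sections are stated below for
   smooth sections over arbitrary open sets. *)
Definition vfield := forall p : M, tangent p.
Definition endfield := M -> 'M[R]_m.
Definition covfield := M -> 'rV[R]_m.

(* k-forms, as fields of functions of k tangent vectors *)
Definition kform (k : nat) := forall p : M, ('I_k -> tangent p) -> R.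

Definition xcoord c (k : 'I_m) (p : M) : R := cmap c p k 0.

Definition smooth_fun U (f : M -> R) : Prop :=
  forall c, smooth_on (cmap c @` (U `&` cdom c)) (f \o cinv c).

(* the derivative v(f) of a function along a tangent vector at p *)
Definition tderiv (p : M) (v : tangent p) (f : M -> R) : R :=
  'D_v (f \o cinv (chart_at p)) (cmap (chart_at p) p).
Arguments tderiv p v f : clear implicits.

Definition smooth_vf U (X : vfield) : Prop :=
  forall c k, smooth_fun (U `&` cdom c) (fun p => tderiv p (X p) (xcoord c k)).

(* the coordinate vector field d/dx_j of the chart c, defined on its domain *)
Definition coord_vf c (j : 'I_m) : vfield := fun p =>
  \col_k 'D_(delta_mx j 0) (xcoord (chart_at p) k \o cinv c) (cmap c p).

Definition bracket (X Y : vfield) : vfield := fun p =>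
  \col_k (tderiv p (X p) (fun q => tderiv q (Y q) (xcoord (chart_at p) k))
        - tderiv p (Y p) (fun q => tderiv q (X q) (xcoord (chart_at p) k))).

Definition ap (F : endfield) (X : vfield) : vfield := fun p => F p *m X p.

Definition cov (a : covfield) (p : M) (v : tangent p) : R := (a p *m v) 0 0.
Arguments cov a p v : clear implicits.

Definition met (g : endfield) (p : M) (u v : tangent p) : R :=
  (u^T *m g p *m v) 0 0.
Arguments met g p u v : clear implicits.

Definition smooth_end U (F : endfield) : Prop :=
  forall V X, open V -> V `<=` U -> smooth_vf V X -> smooth_vf V (ap F X).

Definition smooth_cov U (a : covfield) : Prop :=
  forall V X, open V -> V `<=` U -> smooth_vf V X ->
    smooth_fun V (fun p => cov a p (X p)).

Definition riemannian_metric (g : endfield) : Prop :=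
  [/\ forall p, (g p)^T = g p,
      forall p (v : tangent p), v != 0 -> 0 < met g p v v
    & forall U X Y, open U -> smooth_vf U X -> smooth_vf U Y ->
        smooth_fun U (fun p => met g p (X p) (Y p))].

Definition form_of_cov (a : covfield) : kform 1 := fun p v => cov a p (v ord0).

Definition form_of_bilin (B : forall p, tangent p -> tangent p -> R) :
    kform 2 := fun p v => B p (v ord0) (v ord_max).

(* normalised so that (a /\ b)(X, Y) = a(X)b(Y) - a(Y)b(X) for 1-forms, as
   required by d without numerical factors *)
Definition wedge k l (a : kform k) (b : kform l) : kform (k + l) := fun p v =>
  ((k`! * l`!)%N%:R)^-1 *
  \sum_(s : 'S_(k + l)) (-1) ^+ s *
    (a p (fun i => v (s (lshift l i))) * b p (fun j => v (s (rshift k j)))).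
Arguments wedge {k l} a b p v.

Definition d1 (a : covfield) (X Y : vfield) (p : M) : R :=
  tderiv p (X p) (fun q => cov a q (Y q))
  - tderiv p (Y p) (fun q => cov a q (X q))
  - cov a p (bracket X Y p).

Definition d2 (B : forall p, tangent p -> tangent p -> R)
    (X Y Z : vfield) (p : M) : R :=
  tderiv p (X p) (fun q => B q (Y q) (Z q))
  - tderiv p (Y p) (fun q => B q (X q) (Z q))
  + tderiv p (Z p) (fun q => B q (X q) (Y q))
  - B p (bracket X Y p) (Z p)
  + B p (bracket X Z p) (Y p)
  - B p (bracket Y Z p) (X p).

(* the Lie derivative (L_xi F) X *)
Definition lie_end (xi : vfield) (F : endfield) (X : vfield) : vfield :=
  fun p => bracket xi (ap F X) p - F p *m bracket xi X p.

Definition killing (g : endfield) (xi : vfield) : Prop :=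
  forall U X Y p, open U -> smooth_vf U X -> smooth_vf U Y -> U p ->
    tderiv p (xi p) (fun q => met g q (X q) (Y q)) =
    met g p (bracket xi X p) (Y p) + met g p (X p) (bracket xi Y p).

(* [D p v Y] is the covariant derivative at p of Y along v; it acts on the
   smooth vector fields defined on a neighbourhood of p. *)
Definition connection := forall p : M, tangent p -> vfield -> tangent p.

Definition is_connection (D : connection) : Prop :=
  [/\ forall U Y p a (u v : tangent p), open U -> U p -> smooth_vf U Y ->
        D p (a *: u + v) Y = a *: D p u Y + D p v Y,
      forall U Y Z p (v : tangent p), open U -> U p ->
        smooth_vf U Y -> smooth_vf U Z ->
        D p v (fun q => Y q + Z q) = D p v Y + D p v Z,
      forall U f Y p (v : tangent p), open U -> U p ->
        smooth_fun U f -> smooth_vf U Y ->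
        D p v (fun q => f q *: Y q) = tderiv p v f *: Y p + f p *: D p v Y,
      forall U Y Z p (v : tangent p), open U -> U p ->
        smooth_vf U Y -> smooth_vf U Z -> (forall q, U q -> Y q = Z q) ->
        D p v Y = D p v Z
    & forall U X Y, open U -> smooth_vf U X -> smooth_vf U Y ->
        smooth_vf U (fun p => D p (X p) Y)].

Definition metric_connection (g : endfield) (D : connection) : Prop :=
  forall U Y Z p (v : tangent p), open U -> U p ->
    smooth_vf U Y -> smooth_vf U Z ->
    tderiv p v (fun q => met g q (Y q) (Z q)) =
    met g p (D p v Y) (Z p) + met g p (Y p) (D p v Z).

Definition torsion (D : connection) (X Y : vfield) : vfield := fun p =>
  D p (X p) Y - D p (Y p) X - bracket X Y p.

Definition skew_torsion (g : endfield) (D : connection) : Prop :=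
  forall U X Y Z p, open U -> U p ->
    smooth_vf U X -> smooth_vf U Y -> smooth_vf U Z ->
    met g p (torsion D X Y p) (Z p) = - met g p (torsion D Y X p) (Z p) /\
    met g p (torsion D X Y p) (Z p) = - met g p (torsion D X Z p) (Y p).

(* (nabla_v F) Y at p *)
Definition nabla_end (D : connection) (F : endfield) (p : M) (v : tangent p)
    (Y : vfield) : tangent p := D p v (ap F Y) - F p *m D p v Y.
Arguments nabla_end D F p v Y : clear implicits.

(* (nabla_v w)(Y_0, ..., Y_(k-1)) at p *)
Definition nabla_form (D : connection) k (w : kform k) (p : M) (v : tangent p)
    (Y : 'I_k -> vfield) : R :=
  tderiv p v (fun q => w q (fun i => Y i q))
  - \sum_(i < k) w p (fun j => if j == i then D p v (Y i) else Y j p).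
Arguments nabla_form D {k} w p v Y.

Definition parallel_form (D : connection) k (w : kform k) : Prop :=
  forall U (Y : 'I_k -> vfield) p (v : tangent p), open U -> U p ->
    (forall i, smooth_vf U (Y i)) -> nabla_form D w p v Y = 0.

Section AlongCurves.
Implicit Types (J : set R) (gamma : R -> M).

Definition smooth_curve J gamma : Prop :=
  (forall t, J t -> {for t, continuous gamma}) /\
  forall c k, smooth_on (J `&` gamma @^-1` cdom c) (xcoord c k \o gamma).

Definition velocity gamma (t : R) : tangent (gamma t) :=
  \col_k derive1 (xcoord (chart_at (gamma t)) k \o gamma) t.

Definition smooth_along J gamma (V : forall t, tangent (gamma t)) : Prop :=
  forall c k, smooth_on (J `&` gamma @^-1` cdom c)
    (fun t => tderiv (gamma t) (V t) (xcoord c k)).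

(* The covariant derivative DV/dt: in the chart c around gamma t, V is
   sum_j V^j d/dx_j and DV/dt = sum_j (V^j)' d/dx_j + V^j nabla_gamma' d/dx_j *)
Definition nabla_along (D : connection) gamma (V : forall t, tangent (gamma t))
    (t : R) : tangent (gamma t) :=
  let p := gamma t in let c := chart_at p in
  let Vc j s := tderiv (gamma s) (V s) (xcoord c j) in
  \sum_(j < m) (derive1 (Vc j) t *: coord_vf c j p
                 + Vc j t *: D p (velocity gamma t) (coord_vf c j)).

(* P is the parallel transport along a smooth curve [0, 1] -> M from p to q
   (smoothness on the closed interval: existence of a smooth extension). *)
Definition transport_smooth (D : connection) (p q : M) (P : 'M[R]_m) : Prop :=
  exists gamma J,
    [/\ open J, `[0, 1] `<=` J, smooth_curve J gamma, gamma 0 = p /\ gamma 1 = q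
      & forall v : 'cV[R]_m, exists V : forall t, tangent (gamma t),
          [/\ smooth_along J V, forall t, J t -> nabla_along D V t = 0,
              V 0 = v & V 1 = P *m v]].

(* parallel transport along piecewise smooth curves *)
Inductive transport (D : connection) : M -> M -> 'M[R]_m -> Prop :=
| transport_id p : transport D p p 1%:M
| transport_trans p q r P Q :
    transport_smooth D p q P -> transport D q r Q -> transport D p r (Q *m P).

Definition holonomy_group (D : connection) (p : M) : set 'M[R]_m :=
  [set P | transport D p p P].

(* the Lie algebra of the holonomy group: the generators of the one-parameter
   subgroups of GL(T_p M) contained in it *)
Definition holonomy_algebra (D : connection) (p : M) : set 'M[R]_m :=
  [set A | exists e : R -> 'M[R]_m,
    [/\ forall s t, e (s + t) = e s *m e t,
        forall t, holonomy_group D p (e t)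
      & forall i j, is_derive (0 : R) (1 : R) (fun t => e t i j) (A i j)]].

End AlongCurves.
End Calculus.

Arguments tderiv {R m M} p v f.
Arguments cov {R m M} a p v.
Arguments met {R m M} g p u v.
Arguments nabla_end {R m M} D F p v Y.
Arguments wedge {R m M k l} a b p v.
Arguments nabla_form {R m M} D {k} w p v Y.
Arguments vfield {R m} M.
Arguments endfield {R m} M.
Arguments covfield {R m} M.
Arguments connection {R m} M.

Definition even_triple (i j k : 'I_3) : Prop :=
  exists s : 'S_3, [/\ ~~ odd_perm s, s 0 = i, s 1 = j & s 2%:R = k].

Section AlmostContact.
Variables (R : realType) (m : nat) (M : manifold R m).

Section One.
Variables (phi : endfield M) (xi : vfield M) (eta : covfield M)
  (g : endfield M).

Definition almost_contact_metric : Prop :=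
  [/\ [/\ smooth_end setT phi, smooth_vf setT xi, smooth_cov setT eta
        & riemannian_metric g],
      forall p, phi p *m phi p = - 1%:M + xi p *m eta p,
      forall p, cov eta p (xi p) = 1
    & forall p (u v : tangent p), met g p (phi p *m u) (phi p *m v) =
        met g p u v - cov eta p u * cov eta p v].

Definition Phi (p : M) (u v : tangent p) : R := met g p u (phi p *m v).

Definition nijenhuis (X Y : vfield M) : vfield M := fun p =>
  bracket (ap phi X) (ap phi Y) p + phi p *m (phi p *m bracket X Y p)
  - phi p *m bracket (ap phi X) Y p - phi p *m bracket X (ap phi Y) p
  + d1 eta X Y p *: xi p.

Definition nijenhuis3 (X Y Z : vfield M) (p : M) : R :=
  met g p (nijenhuis X Y p) (Z p).

End One.

Arguments Phi : clear implicits.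

Variables (phi : 'I_3 -> endfield M) (xi : 'I_3 -> vfield M)
  (eta : 'I_3 -> covfield M) (g : endfield M).

Definition almost_3contact_metric : Prop :=
  (forall i, almost_contact_metric (phi i) (xi i) (eta i) g) /\
  forall i j k, even_triple i j k -> forall p,
    [/\ phi k p = phi i p *m phi j p - xi i p *m eta j p /\
        phi k p = - (phi j p *m phi i p) + xi j p *m eta i p,
        xi k p = phi i p *m xi j p /\ xi k p = - (phi j p *m xi i p)
      & eta k p = eta i p *m phi j p /\ eta k p = - (eta j p *m phi i p)].

Definition horizontal (p : M) (v : tangent p) : Prop :=
  forall i, cov (eta i) p v = 0.
Arguments horizontal p v : clear implicits.

(* smooth sections of the horizontal bundle over U *)
Definition hsection (U : set M) (X : vfield M) : Prop :=
  smooth_vf U X /\ forall p, U p -> horizontal p (X p).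

Definition Atensor (i j : 'I_3) (X Y : vfield M) (p : M) : R :=
  met g p (lie_end (xi j) (phi i) X p) (Y p)
  + d1 (eta j) X (ap (phi i) Y) p + d1 (eta j) (ap (phi i) X) Y p.

Definition reeb_killing_function (beta : M -> R) : Prop :=
  smooth_fun setT beta /\
  forall U X Y p, open U -> U p -> hsection U X -> hsection U Y ->
    (forall i, Atensor i i X Y p = 0) /\
    forall i j k, even_triple i j k ->
      Atensor i j X Y p = beta p * Phi (phi k) g p (X p) (Y p) /\
      - Atensor j i X Y p = beta p * Phi (phi k) g p (X p) (Y p).

(* canonical, with beta as Reeb Killing function *)
Definition canonical_acm3 (beta : M -> R) : Prop :=
  [/\ forall i U X Y Z p, open U -> U p ->
        hsection U X -> hsection U Y -> hsection U Z ->
        let N := nijenhuis3 (phi i) (xi i) (eta i) g in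
        N X Y Z p = - N Y X Z p /\ N X Y Z p = - N X Z Y p,
      forall i, killing g (xi i),
      forall U X Y Z p, open U -> U p ->
        hsection U X -> hsection U Y -> hsection U Z ->
        let E i := nijenhuis3 (phi i) (xi i) (eta i) g X Y Z p
          - d2 (Phi (phi i) g) (ap (phi i) X) (ap (phi i) Y) (ap (phi i) Z) p in
        forall i j, E i = E j
    & reeb_killing_function beta].

Definition canonical_connection (beta : M -> R) (D : connection M) : Prop :=
  [/\ is_connection D, metric_connection g D, skew_torsion g D
    & forall i j k, even_triple i j k ->
        forall U Y p (v : tangent p), open U -> U p -> smooth_vf U Y ->
        nabla_end D (phi i) p v Y =
        beta p *: (cov (eta k) p v *: (phi j p *m Y p)
                   - cov (eta j) p v *: (phi k p *m Y p))].

(* smooth sections over U of the bundle spanned by the phi_i *)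
Definition upsilon_section (U : set M) (F : endfield M) : Prop :=
  smooth_end U F /\
  forall p, U p -> exists a : 'I_3 -> R, F p = \sum_i a i *: phi i p.

Definition preserves_upsilon (D : connection M) : Prop :=
  forall U (X : vfield M) F, open U -> smooth_vf U X -> upsilon_section U F ->
    exists G, upsilon_section U G /\
      forall V Y p, open V -> V `<=` U -> V p -> smooth_vf V Y ->
        nabla_end D F p (X p) Y = G p *m Y p.

Definition fundamental_form (i : 'I_3) : kform M 2 :=
  form_of_bilin (Phi (phi i) g).

Definition Psi : kform M (2 + 2) := fun p v =>
  \sum_(i < 3) wedge (fundamental_form i) (fundamental_form i) p v.

Definition eta123 : kform M (1 + 1 + 1) :=
  wedge (wedge (form_of_cov (eta 0)) (form_of_cov (eta 1)))
        (form_of_cov (eta 2%:R)).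

(* The Lie algebras below act on the tangent space at p; an algebra acting on
   the horizontal (resp. vertical) subspace is extended by 0 to the vertical
   (resp. horizontal) one. *)
Definition skew_end (p : M) (A : 'M[R]_m) : Prop :=
  forall u v : tangent p, met g p (A *m u) v = - met g p u (A *m v).

Definition so_H (p : M) : set 'M[R]_m :=
  [set A | skew_end p A /\ forall i, A *m xi i p = 0].

Definition so_V (p : M) : set 'M[R]_m :=
  [set A | skew_end p A /\ forall v : tangent p, horizontal p v -> A *m v = 0].

Definition sp_n (p : M) : set 'M[R]_m :=
  [set A | so_H p A /\ forall i (v : tangent p), horizontal p v ->
             A *m (phi i p *m v) = phi i p *m (A *m v)].

Definition sp_1 (p : M) : set 'M[R]_m :=
  [set A | (forall i, A *m xi i p = 0) /\
           exists a : 'I_3 -> R, forall v : tangent p, horizontal p v ->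
             A *m v = \sum_i a i *: (phi i p *m v)].

Definition so_H_so_V (p : M) : set 'M[R]_m :=
  [set A + B | A in so_H p & B in so_V p].

Definition sp_n_sp_1_so_V (p : M) : set 'M[R]_m :=
  [set A + B | A in [set S + Q | S in sp_n p & Q in sp_1 p] & B in so_V p].

End AlmostContact.

(* Main.v *)
Require Import Defs.
From mathcomp Require Import all_boot all_order all_algebra all_fingroup.
From mathcomp Require Import all_classical all_reals all_analysis.
From mathcomp Require Import ring.
Set Implicit Arguments.
Unset Strict Implicit.
Unset Printing Implicit Defensive.
Import Order.TTheory GRing.Theory Num.Theory.
Import numFieldNormedType.Exports.
Local Open Scope classical_set_scope.
Local Open Scope ring_scope.

(* In the frame xi_1, xi_2, xi_3 the connection acts on the xi_i, the eta_i and
   the Phi_i through one and the same skew-symmetric matrix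
   beta (eta_k(v) (.)_j - eta_j(v) (.)_k), that is, by infinitesimal rotations
   of R^3.  For the Phi_i this is a hypothesis; for the xi_i it follows by
   differentiating phi_i xi_i = 0.  Hence every rotation invariant built from
   them is parallel: Psi, eta_1 /\ eta_2 /\ eta_3, and also the tensors
   sum_i eta_i (x) eta_i and sum_i Phi_i (x) Phi_i.

   For the holonomy no existence theorem for parallel transport is needed: if V
   and W are parallel along a curve, g(V, W) and the contractions of the two
   tensors above with parallel fields have derivative 0, so every element of the
   holonomy group preserves g and these tensors, and every element A of the
   holonomy algebra annihilates them.  By skewness and the first tensor A
   preserves H and V; evaluating the second one on vertical vectors gives
   [A, phi_j] = sum_i c_ji phi_i with c skew-symmetric, and subtracting from A
   the element of sp(1) with the same brackets leaves an element of sp(n)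
     on H. *)

(** * Smooth functions on open sets of a normed space *)

Section Differentiability.
Variables (R : realType) (E F : normedModType R).

(** Since [z] vanishes near [x], the zero linear map satisfies the little-o expansion that
    characterises the differential. *)
Lemma differentiable_near0 (z : E -> F) (x : E) :
  (\near x, z x = 0) -> differentiable z x.
Proof.
move=> z0.
have zx : z x = 0 by exact: nbhs_singleton z0.
have zo : z \o shift x = (cst (z x) + 0) +o_ 0 id.
  apply/eqaddoP => e e0.
  have h : \forall y \near 0, z (y + x) = 0.
    by have := z0; rewrite (near_shift 0) subr0.
  near=> y; rewrite /= !fctE zx.
  rewrite (_ : z (y + x) = 0); last by near: y.
  by rewrite addr0 subr0 normr0 mulr_ge0// ltW.
have dz : 'd z x = (\0 : {linear E -> F}) :> (E -> F).
  by apply: diff_unique; [exact: cst_continuous | exact: zo].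
by apply/diff_locallyP; split; rewrite dz //; exact: cst_continuous.
Unshelve. all: by end_near. Qed.

(** Differentiability is local because [g] is [f] plus the difference [g - f], which vanishes near
    [x]. *)
Lemma near_eq_differentiable (f g : E -> F) (x : E) :
  (\near x, f x = g x) -> differentiable f x -> differentiable g x.
Proof.
move=> fg df; have -> : g = f + (g - f) by rewrite addrC subrK.
apply: differentiableD => //; apply: differentiable_near0.
by apply: filterS fg => y fgy; rewrite !fctE fgy subrr.
Qed.
End Differentiability.

Section Derivations.
Variables (R : realType) (E : normedModType R).
Implicit Types (x v : E) (f g : E -> R).

Lemma derive_comp (F G : normedModType R) (t : E -> F) (f : F -> G) x v :
  differentiable t x -> differentiable f (t x) ->
  'D_v (f \o t) x = 'D_('D_v t x) f (t x).
Proof.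
move=> dt df; rewrite !deriveE//; last exact: differentiable_comp.
by rewrite diff_comp.
Qed.

Lemma differentiable_col (m : nat) (t : E -> 'cV[R]_m) x :
  (forall k, differentiable (fun y => t y k 0) x) -> differentiable t x.
Proof.
move=> dt.
have -> : t = \sum_(k < m) (fun y => t y k 0 *: (delta_mx k 0 : 'cV[R]_m)).
  apply/funext => y; rewrite fct_sumE; apply/colP => k.
  rewrite summxE (bigD1 k)//= !mxE !eqxx mulr1 big1 ?addr0// => j jk.
  by rewrite !mxE eq_sym (negPf jk) mulr0.
by apply: differentiable_sum => k; exact: differentiableZl.
Qed.

Lemma derive_col (m : nat) (t : E -> 'cV[R]_m) x v :
  (forall k, differentiable (fun y => t y k 0) x) ->
  'D_v t x = \col_k 'D_v (fun y => t y k 0) x.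
Proof.
move=> dt; rewrite derive_mx.
  by apply/matrixP => i j; rewrite !mxE (ord1 j).
exact/diff_derivable/differentiable_col.
Qed.

Lemma derive_combination (G F : normedModType R) (n : nat) (f : G -> F) (x : G)
    (a : 'I_n -> R) (v : 'I_n -> G) : differentiable f x ->
  'D_(\sum_j a j *: v j) f x = \sum_j a j *: 'D_(v j) f x.
Proof.
move=> df; rewrite deriveE// linear_sum.
by apply: eq_bigr => j _; rewrite linearZ deriveE.
Qed.

Lemma derive_comp_col (m : nat) (t : E -> 'cV[R]_m) (f : 'cV[R]_m -> R) x v :
  (forall k, differentiable (fun y => t y k 0) x) -> differentiable f (t x) ->
  'D_v (f \o t) x =
  \sum_j 'D_v (fun y => t y j 0) x * 'D_(delta_mx j 0) f (t x).
Proof.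
move=> dt df; rewrite derive_comp//; last exact: differentiable_col.
rewrite derive_col// [X in 'D_X f _]matrix_sum_delta.
under eq_bigr do rewrite big_ord1 mxE.
exact: derive_combination.
Qed.

Lemma derive_add f g x v : differentiable f x -> differentiable g x ->
  'D_v (fun y => f y + g y) x = 'D_v f x + 'D_v g x.
Proof. by move=> df dg; apply: deriveD; exact: diff_derivable. Qed.

Lemma derive_mul f g x v : differentiable f x -> differentiable g x ->
  'D_v (fun y => f y * g y) x = f x * 'D_v g x + g x * 'D_v f x.
Proof. by move=> df dg; apply: deriveM; exact: diff_derivable. Qed.

End Derivations.

Section SmoothOn.
Variables (R : realType) (E : normedModType R).
Implicit Types (U V : set E) (f g : E -> R).

Lemma smooth_on_differentiable U f x :
  smooth_on U f -> U x -> differentiable f x.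
Proof. by move=> /(_ 1%N)[h _]; exact: h. Qed.

Lemma smooth_on_derive U f v : smooth_on U f -> smooth_on U ('D_v f).
Proof. by move=> sf k; exact: (sf k.+1).2. Qed.

Lemma smooth_on_sub U V f : V `<=` U -> smooth_on U f -> smooth_on V f.
Proof.
move=> VU sf k; elim: k f sf => //= k IH f sf; split=> [x Vx|v].
  exact: smooth_on_differentiable sf (VU _ Vx).
exact/IH/smooth_on_derive.
Qed.

(** Openness of [U] turns equality on [U] into equality near each of its points, so the directional
    derivatives agree on [U] too and the induction continues. *)
Lemma times_differentiable_eq k U f g : open U -> (forall x, U x ->
  f x = g x) ->
  times_differentiable k U f -> times_differentiable k U g.
Proof.
move=> oU; elim: k f g => //= k IH f g fg [df Df].
have fgn x : U x -> \near x, f x = g x.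
  by move=> Ux; apply: filterS fg _; exact: open_nbhs_nbhs.
split=> [x Ux|v]; first exact: near_eq_differentiable (fgn x Ux) (df x Ux).
by apply: IH (Df v) => x /fgn; exact: near_eq_derive.
Qed.

Lemma smooth_on_eq U f g : open U -> (forall x, U x -> f x = g x) ->
  smooth_on U f -> smooth_on U g.
Proof. by move=> oU fg sf k; exact: times_differentiable_eq fg (sf k). Qed.

Lemma smooth_on_cst U (a : R) : smooth_on U (cst a).
Proof.
move=> k; elim: k a => //= k IH a; split=> [x _|v].
  exact: differentiable_cst.
by have -> : 'D_v (cst a : E -> R) = cst 0 by apply/funext => x;
  exact: derive_cst.
Qed.

Lemma times_differentiable_add k U f g : open U ->
  times_differentiable k U f -> times_differentiable k U g ->
  times_differentiable k U (fun x => f x + g x).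
Proof.
move=> oU; elim: k f g => //= k IH f g [df Df] [dg Dg]; split=> [x Ux|v].
  by apply: differentiableD; [exact: df|exact: dg].
apply: times_differentiable_eq (IH _ _ (Df v) (Dg v)) => // x Ux /=.
by rewrite derive_add//; [exact: df|exact: dg].
Qed.

Lemma smooth_on_add U f g : open U -> smooth_on U f -> smooth_on U g ->
  smooth_on U (fun x => f x + g x).
Proof. by move=> oU sf sg k; exact: times_differentiable_add. Qed.

(** The product rule leaves one factor undifferentiated; the induction for
    [times_differentiable_mul] uses that factor at the lower order. *)
Lemma times_differentiable_le k U f :
  times_differentiable k.+1 U f -> times_differentiable k U f.
Proof.
elim: k f => // k IH f [df Df]; split=> // v; exact/IH/Df.
Qed.

Lemma times_differentiable_mul k U f g : open U ->
  times_differentiable k U f -> times_differentiable k U g ->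
  times_differentiable k U (fun x => f x * g x).
Proof.
move=> oU; elim: k f g => // k IH f g sf sg.
have [df Df] := sf; have [dg Dg] := sg.
split=> [x Ux|v]; first by apply: differentiableM; [exact: df|exact: dg].
apply: (@times_differentiable_eq k U (fun x => f x * 'D_v g x +
  g x * 'D_v f x)).
- by [].
- by move=> x Ux; rewrite derive_mul//; [exact: df|exact: dg].
- by apply: times_differentiable_add => //; apply: IH => //;
    solve [exact: times_differentiable_le | exact: Df | exact: Dg].
Qed.

Lemma smooth_on_mul U f g : open U -> smooth_on U f -> smooth_on U g ->
  smooth_on U (fun x => f x * g x).
Proof. by move=> oU sf sg k; exact: times_differentiable_mul. Qed.

Lemma times_differentiable_sum k U (n : nat) (f : 'I_n -> E -> R) : open U ->
  (forall i, times_differentiable k U (f i)) ->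
  times_differentiable k U (fun x => \sum_i f i x).
Proof.
move=> oU; elim: n f => [|n IH] f sf.
  apply: times_differentiable_eq (smooth_on_cst U 0 k) => // x _.
  by rewrite big_ord0.
have := times_differentiable_add oU (sf ord0) (IH _ (fun i =>
  sf (lift ord0 i))).
by apply: times_differentiable_eq => // x _; rewrite big_ord_recl.
Qed.

End SmoothOn.

(** By the chain rule each derivative of [f \o t] is a sum of products of a derivative of a
    component of [t] and a partial derivative of [f] composed with [t]. The induction on the order
    is over all [f], hence covers these partial derivatives. *)
Lemma smooth_on_comp (R : realType) (E : normedModType R) (m : nat) (U : set E)
    (W : set 'cV[R]_m) (t : E -> 'cV[R]_m)
    (f : 'cV[R]_m -> R) : open U -> (forall x, U x -> W (t x)) ->
  (forall j, smooth_on U (fun x => t x j 0)) -> smooth_on W f ->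
  smooth_on U (f \o t).
Proof.
move=> oU UW st sf k; elim: k f sf => //= k IH f sf.
have dt x : U x -> forall j, differentiable (fun y => t y j 0) x.
  by move=> Ux j; exact: smooth_on_differentiable (st j) Ux.
have df x : U x -> differentiable f (t x).
  by move=> Ux; exact: smooth_on_differentiable sf (UW _ Ux).
split=> [x Ux|v].
  by apply: differentiable_comp; [exact/differentiable_col/dt|exact: df].
apply: (@times_differentiable_eq _ _ k U (fun x => \sum_j
    'D_v (fun y => t y j 0) x * ('D_(delta_mx j 0) f \o t) x)) => //.
  by move=> x Ux; rewrite derive_comp_col//; [exact: dt|exact: df].
apply: times_differentiable_sum => // j; apply: times_differentiable_mul => //.
  exact: smooth_on_derive (st j) _.
by apply: IH; exact: smooth_on_derive.
Qed.

(** * Calculus on a manifold *)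

Section ManifoldCalculus.
Variables (R : realType) (m : nat) (M : manifold R m).
Implicit Types (p q : M) (c d : chart M) (U V : set M) (f g : M -> R).
Implicit Types (X Y : vfield M).

(** The image is the part of the open chart range that the inverse chart, continuous there, sends
    into [U]. *)
Lemma open_chart_image U c : open U -> open (cmap c @` (U `&` cdom c)).
Proof.
move=> oU; rewrite openE => _ [p [Up cp] <-] /=.
have cr : (cmap c @` cdom c) (cmap c p) by exists p.
have nU : nbhs (cinv c (cmap c p)) U.
  by rewrite cmapK//; exact: open_nbhs_nbhs.
have near_crange : \forall x \near cmap c p, (cmap c @` cdom c) x.
  by apply: open_nbhs_nbhs; split=> //; exact: crange_open.
have nUc : \forall x \near cmap c p, U (cinv c x) := cinv_continuous cr nU.
rewrite /interior; near=> x.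
have [q cq qx] : (cmap c @` cdom c) x by near: x.
exists q => //; split=> //; rewrite -(cmapK cq) qx; near: x.
exact: nUc.
Unshelve. all: by end_near.
Qed.

Lemma near_chart_image U c p : open U -> U p -> cdom c p ->
  \forall x \near cmap c p, (cmap c @` (U `&` cdom c)) x.
Proof.
by move=> oU Up cp; apply: open_nbhs_nbhs; split;
  [exact: open_chart_image | exists p].
Qed.

Lemma near_transition (f : M -> R) c d p : cdom c p -> cdom d p ->
  \forall x \near cmap c p,
    ((f \o cinv d) \o (fun y => cmap d (cinv c y))) x = (f \o cinv c) x.
Proof.
move=> cp dp; have := near_chart_image (cdom_open d) dp cp.
by apply: filterS => _ [q [dq cq] <-] /=; rewrite cmapK// cmapK.
Qed.

Lemma differentiable_transition c d p k : cdom c p -> cdom d p ->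
  differentiable (fun x => cmap d (cinv c x) k 0) (cmap c p).
Proof.
move=> cp dp; apply: (smooth_on_differentiable (transition_smooth c d k)).
by exists p.
Qed.

Lemma differentiable_chart U f c p : smooth_fun U f -> U p -> cdom c p ->
  differentiable (f \o cinv c) (cmap c p).
Proof.
move=> sf Up cp; apply: (smooth_on_differentiable (sf c)).
by exists p.
Qed.

(** A tangent vector is stored through its components in [chart_at p]. The chain rule for the
    transition map expresses its action through the partial derivatives of any other chart. *)
Lemma tderiv_in_chart U f c p (v : tangent p) : smooth_fun U f -> U p ->
  cdom c p -> tderiv p v f =
  \sum_j tderiv p v (xcoord c j) * 'D_(delta_mx j 0) (f \o cinv c) (cmap c p).
Proof.
move=> sf Up cp; have ap := cdom_chart_at p; rewrite /tderiv.
rewrite -(near_eq_derive v (near_transition f ap cp)) derive_comp_col.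
- by rewrite cmapK.
- by move=> k; exact: differentiable_transition.
- by rewrite cmapK//; exact: differentiable_chart sf Up cp.
Qed.

Lemma tderiv_coord_vf U f c p j : smooth_fun U f -> U p -> cdom c p ->
  tderiv p (coord_vf c j p) f = 'D_(delta_mx j 0) (f \o cinv c) (cmap c p).
Proof.
move=> sf Up cp; have ap := cdom_chart_at p.
have dt k := differentiable_transition k cp ap.
rewrite -(near_eq_derive _ (near_transition f cp ap)) derive_comp.
- by rewrite cmapK// derive_col.
- exact: differentiable_col.
- by rewrite cmapK//; exact: differentiable_chart sf Up ap.
Qed.

Lemma smooth_xcoord c k : smooth_fun (cdom c) (xcoord c k).
Proof.
by move=> d; rewrite setIC; exact: transition_smooth.
Qed.

Lemma tderiv_chart_at p (v : tangent p) k :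
  tderiv p v (xcoord (chart_at p) k) = v k 0.
Proof.
have ap := cdom_chart_at p; rewrite /tderiv.
have /(near_eq_derive v) -> : \forall x \near cmap (chart_at p) p,
    (xcoord (chart_at p) k \o cinv (chart_at p)) x = (fun x => x k 0) x.
  have := near_chart_image (cdom_open _) ap ap.
  by apply: filterS => _ [q [aq _] <-] /=; rewrite /xcoord cmapK.
have := @derive_mx R _ m 1 id (cmap (chart_at p) p) v.
move=> /(_ ltac:(exact: derivable_id)).
by rewrite derive_id => /matrixP/(_ k 0); rewrite mxE => /esym.
Qed.

(** Both sides act alike on the coordinate functions of [chart_at p], and these actions are the
    stored components. *)
Lemma coord_vf_basis c p (v : tangent p) : cdom c p ->
  v = \sum_j tderiv p v (xcoord c j) *: coord_vf c j p.
Proof.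
move=> cp; have ap := cdom_chart_at p; apply/colP => k.
rewrite -(tderiv_chart_at v) (tderiv_in_chart _ (smooth_xcoord _ k) ap cp).
by rewrite summxE; apply: eq_bigr => j _; rewrite !mxE.
Qed.

Lemma smooth_fun_sub U V f : V `<=` U -> smooth_fun U f -> smooth_fun V f.
Proof.
move=> VU sf c; apply: smooth_on_sub (sf c).
by apply: image_subset; exact: setSI.
Qed.

Lemma smooth_fun_eq U f g : open U -> (forall p, U p -> f p = g p) ->
  smooth_fun U f -> smooth_fun U g.
Proof.
move=> oU fg sf c; apply: smooth_on_eq (sf c); first exact: open_chart_image.
by move=> _ [q [Uq cq] <-] /=; rewrite cmapK// fg.
Qed.

Lemma smooth_fun_cst U (a : R) : smooth_fun U (cst a).
Proof. by move=> c; exact: smooth_on_cst. Qed.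

Lemma smooth_fun_add U f g : open U -> smooth_fun U f -> smooth_fun U g ->
  smooth_fun U (fun p => f p + g p).
Proof.
by move=> oU sf sg c; exact: smooth_on_add (open_chart_image oU) (sf c) (sg c).
Qed.

Lemma smooth_fun_mul U f g : open U -> smooth_fun U f -> smooth_fun U g ->
  smooth_fun U (fun p => f p * g p).
Proof.
by move=> oU sf sg c; exact: smooth_on_mul (open_chart_image oU) (sf c) (sg c).
Qed.

Lemma smooth_fun_sum U (I : Type) (r : seq I) (f : I -> M -> R) : open U ->
  (forall i, smooth_fun U (f i)) -> smooth_fun U (fun p => \sum_(i <- r) f i p).
Proof.
move=> oU sf; elim: r => [|i r IH].
  by apply: smooth_fun_eq (smooth_fun_cst U 0) => // p _; rewrite big_nil.
apply: smooth_fun_eq (smooth_fun_add oU (sf i) IH) => // p _.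
by rewrite big_cons.
Qed.

(** Read in another chart [d], the function is a partial derivative taken in [c] composed with the
    smooth transition from [d] to [c]. *)
Lemma smooth_tderiv_coord_vf U f c j : open U -> smooth_fun U f ->
  smooth_fun (U `&` cdom c) (fun p => tderiv p (coord_vf c j p) f).
Proof.
move=> oU sf d; have oUc : open (U `&` cdom c) by exact/openI/cdom_open.
have oI := @open_chart_image _ d oUc.
apply: (@smooth_on_eq _ _ _
  ('D_(delta_mx j 0) (f \o cinv c) \o (fun x => cmap c (cinv d x)))) => //.
  move=> _ [q [[Uq cq] dq] <-] /=; rewrite cmapK//.
  by rewrite (tderiv_coord_vf _ sf).
apply: (@smooth_on_comp _ _ _ _ (cmap c @` (U `&` cdom c))) => //.
- by move=> _ [q [Uq dq] <-] /=; rewrite cmapK//; exists q.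
- move=> k; apply: smooth_on_sub (transition_smooth d c k).
  by apply: image_subset => q [[_ cq] dq].
- exact: smooth_on_derive (sf c).
Qed.

Lemma smooth_coord_vf c j : smooth_vf (cdom c) (coord_vf c j).
Proof.
move=> d k; rewrite setIC.
exact: smooth_tderiv_coord_vf (cdom_open d) (smooth_xcoord d k).
Qed.

Lemma tderiv_linear U f p n (a : 'I_n -> R) (v : 'I_n -> tangent p) :
  smooth_fun U f -> U p ->
  tderiv p (\sum_i a i *: v i) f = \sum_i a i * tderiv p (v i) f.
Proof.
move=> sf Up; apply: derive_combination.
exact: differentiable_chart sf Up (cdom_chart_at p).
Qed.

Lemma tderiv_addv U f p (u v : tangent p) : smooth_fun U f -> U p ->
  tderiv p (u + v) f = tderiv p u f + tderiv p v f.
Proof.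
move=> sf Up; have df := differentiable_chart sf Up (cdom_chart_at p).
by rewrite /tderiv !deriveE// linearD.
Qed.

Lemma tderiv_scalev U f p a (v : tangent p) : smooth_fun U f -> U p ->
  tderiv p (a *: v) f = a * tderiv p v f.
Proof.
move=> sf Up; have df := differentiable_chart sf Up (cdom_chart_at p).
by rewrite /tderiv !deriveE// linearZ.
Qed.

Lemma tderiv_add U f g p (v : tangent p) : smooth_fun U f -> smooth_fun U g ->
  U p -> tderiv p v (fun q => f q + g q) = tderiv p v f + tderiv p v g.
Proof.
move=> sf sg Up; have ap := cdom_chart_at p.
exact: derive_add (differentiable_chart sf Up ap)
  (differentiable_chart sg Up ap).
Qed.

Lemma tderiv_mul U f g p (v : tangent p) : smooth_fun U f -> smooth_fun U g ->
  U p -> tderiv p v (fun q => f q * g q) =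
         f p * tderiv p v g + g p * tderiv p v f.
Proof.
move=> sf sg Up; have ap := cdom_chart_at p; rewrite /tderiv.
have := derive_mul v (differentiable_chart sf Up ap)
  (differentiable_chart sg Up ap).
by rewrite /= cmapK.
Qed.

Lemma tderiv_cst p (v : tangent p) (a : R) : tderiv p v (cst a) = 0.
Proof. exact: derive_cst. Qed.

Lemma tderiv_sum U (I : Type) (r : seq I) (f : I -> M -> R) p
    (v : tangent p) : open U -> (forall i, smooth_fun U (f i)) -> U p ->
  tderiv p v (fun q => \sum_(i <- r) f i q) = \sum_(i <- r) tderiv p v (f i).
Proof.
move=> oU sf Up; elim: r => [|i r IH].
  rewrite big_nil; apply: etrans (tderiv_cst v 0); congr (tderiv p v _).
  by apply/funext => q; rewrite big_nil.
rewrite big_cons -IH -(tderiv_add _ (sf i) (smooth_fun_sum r oU sf) Up).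
by congr (tderiv p v _); apply/funext => q; rewrite big_cons.
Qed.

Lemma tderiv_eq U f g p (v : tangent p) : open U ->
  (forall q, U q -> f q = g q) -> U p -> tderiv p v f = tderiv p v g.
Proof.
move=> oU fg Up; apply: near_eq_derive.
have := near_chart_image oU Up (cdom_chart_at p).
by apply: filterS => _ [q [Uq aq] <-] /=; rewrite cmapK// fg.
Qed.

Lemma smooth_vf_sub U V X : V `<=` U -> smooth_vf U X -> smooth_vf V X.
Proof.
by move=> VU sX c k; apply: smooth_fun_sub (sX c k); exact: setSI.
Qed.

Lemma smooth_vf_eq U X Y : open U -> (forall p, U p -> X p = Y p) ->
  smooth_vf U X -> smooth_vf U Y.
Proof.
move=> oU XY sX c k; apply: smooth_fun_eq (sX c k).
  exact/openI/cdom_open.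
by move=> p [Up _]; rewrite XY.
Qed.

Lemma smooth_vf_add U X Y : open U -> smooth_vf U X -> smooth_vf U Y ->
  smooth_vf U (fun p => X p + Y p).
Proof.
move=> oU sX sY c k; have oUc : open (U `&` cdom c) by exact/openI/cdom_open.
apply: smooth_fun_eq (smooth_fun_add oUc (sX c k) (sY c k)) => //.
by move=> p [_ cp]; rewrite (tderiv_addv _ _ (smooth_xcoord c k)).
Qed.

Lemma smooth_vf_scale U f X : open U -> smooth_fun U f -> smooth_vf U X ->
  smooth_vf U (fun p => f p *: X p).
Proof.
move=> oU sf sX c k; have oUc : open (U `&` cdom c) by exact/openI/cdom_open.
have sf' : smooth_fun (U `&` cdom c) f by apply: smooth_fun_sub sf => p [].
apply: smooth_fun_eq (smooth_fun_mul oUc sf' (sX c k)) => //.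
by move=> p [_ cp]; rewrite (tderiv_scalev _ _ (smooth_xcoord c k)).
Qed.

Lemma smooth_vf_opp U X : open U -> smooth_vf U X -> smooth_vf U (fun p =>
  - X p).
Proof.
move=> oU /(smooth_vf_scale oU (smooth_fun_cst U (-1))).
by apply: smooth_vf_eq => // p _; rewrite scaleN1r.
Qed.

Lemma smooth_vf_sum U n (X : 'I_n -> vfield M) : open U ->
  (forall i, smooth_vf U (X i)) -> smooth_vf U (fun p => \sum_i X i p).
Proof.
move=> oU sX c k; have oUc : open (U `&` cdom c) by exact/openI/cdom_open.
apply: smooth_fun_eq (smooth_fun_sum _ oUc (fun i => sX i c k)) => //.
move=> p [_ cp].
have := tderiv_linear (fun=> 1) (fun i => X i p) (smooth_xcoord c k) cp.
under eq_bigr do rewrite scale1r; move=> ->.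
by apply: eq_bigr => i _; rewrite mul1r.
Qed.

(** By continuity the curve stays in one chart domain near [t], where [f] along [gamma] is a
    composition in coordinates and the chain rule applies. *)
Lemma is_derive_curve (J : set R) (gamma : R -> M) t U f : open J ->
  smooth_curve J gamma -> J t -> smooth_fun U f -> U (gamma t) ->
  is_derive t 1 (f \o gamma) (tderiv (gamma t) (velocity gamma t) f).
Proof.
move=> oJ [cg sg] Jt sf Ut; set c := chart_at (gamma t).
have ct : cdom c (gamma t) := cdom_chart_at _.
have near_c : \forall s \near t, cdom c (gamma s).
  by apply: (cg t Jt); apply: open_nbhs_nbhs; split => //; exact: cdom_open.
have dg k : differentiable (fun s => cmap c (gamma s) k 0) t.
  by apply: (smooth_on_differentiable (sg c k)); split.
have df : differentiable (f \o cinv c) (cmap c (gamma t)).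
  exact: differentiable_chart sf Ut ct.
have fg : \forall s \near t,
    ((f \o cinv c) \o (cmap c \o gamma)) s = (f \o gamma) s.
  by apply: filterS near_c => s cs /=; rewrite cmapK.
have dcg : differentiable (cmap c \o gamma) t by exact: differentiable_col.
have dfg : differentiable (f \o gamma) t.
  by apply: near_eq_differentiable fg _; exact: differentiable_comp.
suff -> : tderiv (gamma t) (velocity gamma t) f = 'D_1 (f \o gamma) t.
  exact/derivableP/diff_derivable.
rewrite -(near_eq_derive _ fg) derive_comp//; congr ('D__ _ _).
rewrite derive_col//; apply/colP => k; rewrite !mxE.
exact: derive1E.
Qed.

End ManifoldCalculus.

(** * Bilinear forms along parallel fields *)

Lemma is_derive_sum_pointwise (R : realType) (n : nat) (h : 'I_n -> R -> R)
    (dh : 'I_n -> R) (t : R) : (forall i, is_derive t 1 (h i) (dh i)) ->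
  is_derive t 1 (fun s => \sum_i h i s) (\sum_i dh i).
Proof.
move=> hd; have -> : (fun s => \sum_i h i s) = \sum_i h i.
  by apply/funext => s; rewrite fct_sumE.
exact: is_derive_sum.
Qed.

Lemma is_derive_mul (R : realType) (f h : R -> R) (df dh t : R) :
  is_derive t 1 f df -> is_derive t 1 h dh ->
  is_derive t 1 (fun s => f s * h s) (df * h t + f t * dh).
Proof.
move=> fd hd; apply: is_derive_eq; rewrite addrC.
by congr (_ + _); rewrite /GRing.scale/= mulrC.
Qed.

Lemma is_derive_trilinear (R : realType) (m n : nat) (x : 'I_m -> R -> R)
    (y : 'I_n -> R -> R) (G : 'I_m -> 'I_n -> R -> R)
    (dx : 'I_m -> R) (dy : 'I_n -> R) (dG : 'I_m -> 'I_n -> R) (t : R) :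
  (forall j, is_derive t 1 (x j) (dx j)) ->
  (forall l, is_derive t 1 (y l) (dy l)) ->
  (forall j l, is_derive t 1 (G j l) (dG j l)) ->
  is_derive t 1 (fun s => \sum_j \sum_l x j s * y l s * G j l s)
    (\sum_j \sum_l ((dx j * y l t + x j t * dy l) * G j l t
                    + x j t * y l t * dG j l)).
Proof.
move=> xd yd Gd; apply: is_derive_sum_pointwise => j.
apply: is_derive_sum_pointwise => l.
by do 2?apply: is_derive_mul.
Qed.

Lemma constant_of_is_derive0 (R : realType) (f : R -> R) (J : set R) :
  `[0, 1] `<=` J -> (forall t, J t -> is_derive t 1 f 0) -> f 1 = f 0.
Proof.
move=> IJ df.
have [|t||c _ fc] := @MVT_segment R f (fun=> 0) 0 1.
- exact: ler01.
- move=> /andP[t0 t1]; apply/df/IJ; rewrite /= in_itv/=.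
  by move: t0 t1; rewrite !bnd_simp => /ltW-> /ltW->.
- apply: derivable_within_continuous => t t01.
  by have [] := df t (IJ _ t01).
by apply/eqP; rewrite -subr_eq0 fc mul0r.
Qed.

(** * Indices modulo 3 *)

Lemma ord3P (P : 'I_3 -> Prop) : P 0 -> P 1 -> P 2%:R -> forall i, P i.
Proof.
move=> P0 P1 P2 [[|[|[|//]]] i3].
- by rewrite (_ : Ordinal i3 = 0)//; exact: val_inj.
- by rewrite (_ : Ordinal i3 = 1)//; exact: val_inj.
- by rewrite (_ : Ordinal i3 = 2%:R)//; exact: val_inj.
Qed.

(** Indices are added modulo 3, so [i], [i + 1], [i + 2%:R] is an even triple for every [i] and the
    three cyclic cases share one formula. *)
Lemma add_ord3 :
  (((1 + 1)%R = 2%:R :> 'I_3) * ((1 + 2%:R)%R = 0%R :> 'I_3) *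
   ((2%:R + 1)%R = 0%R :> 'I_3) * ((2%:R + 2%:R)%R = 1%R :> 'I_3) *
   (forall i : 'I_3, (0 + i)%R = i))%type.
Proof. by do !split; try exact: val_inj; exact: add0r. Qed.

Lemma sum_ord3 (V : nmodType) (f : 'I_3 -> V) :
  \sum_i f i = f 0 + f 1 + f 2%:R.
Proof.
rewrite !big_ord_recl big_ord0 addr0 addrA; congr (_ + f _ + f _);
  exact: val_inj.
Qed.

(* The summands are those of <h x e, k> + <h, k x e> (cross products in R^3). *)
Lemma rotation_invariant (R : comRingType) (e h k : 'I_3 -> R) :
  \sum_i ((e (i + 2%:R) * h (i + 1) - e (i + 1) * h (i + 2%:R)) * k i
    + h i * (e (i + 2%:R) * k (i + 1) - e (i + 1) * k (i + 2%:R))) = 0.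
Proof. by rewrite sum_ord3 !add_ord3; ring. Qed.

(** * Bilinear forms and parallel transport *)

Section BilinearForms.
Variables (R : realType) (m : nat) (M : manifold R m).
Implicit Types (B : endfield M) (p q : M).

Lemma metDl B p (u u' v : tangent p) :
  met B p (u + u') v = met B p u v + met B p u' v.
Proof. by rewrite /met linearD/= !mulmxDl mxE. Qed.

Lemma metDr B p (u v v' : tangent p) :
  met B p u (v + v') = met B p u v + met B p u v'.
Proof. by rewrite /met mulmxDr mxE. Qed.

Lemma metZl B p a (u v : tangent p) : met B p (a *: u) v = a * met B p u v.
Proof. by rewrite /met linearZ/= -!scalemxAl mxE. Qed.

Lemma metZr B p a (u v : tangent p) : met B p u (a *: v) = a * met B p u v.
Proof. by rewrite /met -!scalemxAr mxE. Qed.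

Lemma metNl B p (u v : tangent p) : met B p (- u) v = - met B p u v.
Proof. by rewrite -scaleN1r metZl mulN1r. Qed.

Lemma metNr B p (u v : tangent p) : met B p u (- v) = - met B p u v.
Proof. by rewrite -scaleN1r metZr mulN1r. Qed.

Lemma met0l B p (v : tangent p) : met B p 0 v = 0.
Proof. by rewrite -(scale0r 0) metZl mul0r. Qed.

Lemma met0r B p (u : tangent p) : met B p u 0 = 0.
Proof. by rewrite -(scale0r 0) metZr mul0r. Qed.

Lemma met_suml B p n (u : 'I_n -> tangent p) (v : tangent p) :
  met B p (\sum_i u i) v = \sum_i met B p (u i) v.
Proof. by apply: (big_morph (fun u => met B p u v)) => [x y|];
  rewrite ?metDl ?met0l. Qed.

Lemma met_sumr B p n (u : tangent p) (v : 'I_n -> tangent p) :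
  met B p u (\sum_i v i) = \sum_i met B p u (v i).
Proof. by apply: (big_morph (met B p u)) => [x y|]; rewrite ?metDr ?met0r. Qed.

Definition smooth_bilinear B : Prop := forall U X Y, open U ->
  smooth_vf U X -> smooth_vf U Y -> smooth_fun U (fun p => met B p (X p) (Y p)).

(* [dB p v] is the matrix of the bilinear form (nabla_v B)_p. *)
Definition bilinear_nabla (D : connection M) B
    (dB : forall p, tangent p -> 'M[R]_m) : Prop :=
  forall U Y Z p (v : tangent p), open U -> U p ->
    smooth_vf U Y -> smooth_vf U Z ->
    tderiv p v (fun q => met B q (Y q) (Z q)) =
    met B p (D p v Y) (Z p) + met B p (Y p) (D p v Z)
    + met (fun=> dB p v) p (Y p) (Z p).

(** Both fields are expanded in the coordinate frame around [gamma t]. The product rule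
    differentiates the components, [bilinear_nabla] differentiates [B] on pairs of frame fields, and
    the terms regroup into [nabla_along]. *)
Lemma is_derive_bilinear_along (D : connection M) (J : set R) (gamma : R -> M)
    B dB (V W : forall t, tangent (gamma t)) t :
  open J -> smooth_curve J gamma ->
  smooth_bilinear B -> bilinear_nabla D B dB ->
  smooth_along J V -> smooth_along J W -> J t ->
  is_derive t 1 (fun s => met B (gamma s) (V s) (W s))
    (met B (gamma t) (nabla_along D V t) (W t)
     + met B (gamma t) (V t) (nabla_along D W t)
     + met (fun=> dB (gamma t) (velocity gamma t)) (gamma t) (V t) (W t)).
Proof.
move=> oJ sgamma sB nB sV sW Jt; set c := chart_at (gamma t).
have ct : cdom c (gamma t) := cdom_chart_at _.
have near_c : \forall s \near t, cdom c (gamma s).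
  by apply: (sgamma.1 t Jt); apply: open_nbhs_nbhs; split => //;
    exact: cdom_open.
pose x V j s := tderiv (gamma s) (V s) (xcoord c j).
pose e j := coord_vf c j.
have dx V' j : smooth_along J V' -> is_derive t 1 (x V' j) (derive1 (x V' j) t).
  move=> /(_ c j)/smooth_on_differentiable => /(_ t (conj Jt ct)) dV.
  by rewrite derive1E; apply/derivableP/diff_derivable.
have dG j l := is_derive_curve oJ sgamma Jt
  (sB _ _ _ (cdom_open c) (smooth_coord_vf c j) (smooth_coord_vf c l)) ct.
have dF := is_derive_trilinear (fun j => dx V j sV) (fun j => dx W j sW) dG.
have expand B' s : cdom c (gamma s) -> met B' (gamma s) (V s) (W s) =
    \sum_j \sum_l x V j s * x W l s * met B' (gamma s) (e j (gamma s))
      (e l (gamma s)).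
  move=> cs; rewrite {1}(coord_vf_basis (V s) cs) {1}(coord_vf_basis (W s) cs).
  rewrite met_suml; apply: eq_bigr => j _; rewrite met_sumr.
  by apply: eq_bigr => l _; rewrite metZl metZr mulrA.
have near_expand : \forall s \near t, \sum_j \sum_l x V j s * x W l s *
    met B (gamma s) (e j (gamma s)) (e l (gamma s)) =
    met B (gamma s) (V s) (W s).
  by apply: filterS near_c => s /expand ->.
apply: is_derive_eq (near_eq_is_derive near_expand dF) _.
(* Both sides become double sums over the coordinate frame and are compared summand by summand. *)
rewrite !expand//.
rewrite (coord_vf_basis (W t) ct) (coord_vf_basis (V t) ct).
rewrite /nabla_along !met_suml -!big_split/=; apply: eq_bigr => j _.
rewrite !met_sumr -!big_split/=; apply: eq_bigr => l _.
rewrite !(metDl, metDr, metZl, metZr) (nB _ _ _ _ _ (cdom_open c) ct);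
  last 2 first.
- exact: smooth_coord_vf.
- exact: smooth_coord_vf.
rewrite -/(e j) -/(e l) -/c.
do 2!move: (derive1 _ t) => ?; rewrite /x.
do 2!move: (tderiv _ _ _) => ?; do 4!move: (met _ _ _ _) => ?; ring.
Qed.

Lemma met_zero p (u w : tangent p) : met (fun=> 0) p u w = 0.
Proof. by rewrite /met mulmx0 mul0mx mxE. Qed.

Lemma met_rotation (B B' : endfield M) (a b : R) p (u w : tangent p) :
  met (fun=> a *: B p - b *: B' p) p u w = a * met B p u w - b * met B' p u w.
Proof. by rewrite /met mulmxBr mulmxBl -!scalemxAr -!scalemxAl !mxE. Qed.

(** On each smooth piece of the path, [B] of two parallel fields has derivative 0, hence equal
    values at the ends; the pieces are chained by induction. *)
Lemma transport_parallel_bilinear (D : connection M) B p q (P : 'M[R]_m) :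
  smooth_bilinear B -> bilinear_nabla D B (fun _ _ => 0) ->
  transport D p q P ->
  forall u w, met B q (P *m u) (P *m w) = met B p u w.
Proof.
move=> sB nB; elim=> {p q P} [p u w|p q r P Q PP _ IH u w];
  first by rewrite !mul1mx.
rewrite -!mulmxA IH; have [gamma [J [oJ IJ sg [<- <-] par]]] := PP.
have [V [sV nV <- <-]] := par u; have [W [sW nW <- <-]] := par w.
apply: (@constant_of_is_derive0 _
  (fun t => met B (gamma t) (V t) (W t)) J IJ) => t Jt.
apply: is_derive_eq (is_derive_bilinear_along oJ sg sB nB sV sW Jt) _.
by rewrite nV// nW// met0l met0r met_zero !addr0.
Qed.

(** Along parallel fields the triple of values of the [B i] is rotated, and two such triples are
    rotated at the same rate. Their scalar product is therefore constant, by
    [rotation_invariant]. *)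
Lemma transport_rotating_bilinears (D : connection M) (B : 'I_3 -> endfield M)
    (e : forall p, tangent p -> 'I_3 -> R) p q (P : 'M[R]_m) :
  (forall i, smooth_bilinear (B i)) ->
  (forall i, bilinear_nabla D (B i) (fun p v =>
     e p v (i + 2%:R) *: B (i + 1) p - e p v (i + 1) *: B (i + 2%:R) p)) ->
  transport D p q P ->
  forall u w u' w',
    \sum_i met (B i) q (P *m u) (P *m w) * met (B i) q (P *m u') (P *m w') =
    \sum_i met (B i) p u w * met (B i) p u' w'.
Proof.
move=> sB nB; elim=> {p q P} [p u w u' w'|p q r P Q PP _ IH u w u' w'].
  by rewrite !mul1mx.
rewrite -!mulmxA IH; have [gamma [J [oJ IJ sg [<- <-] par]]] := PP.
have [V [sV nV <- <-]] := par u; have [W [sW nW <- <-]] := par w.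
have [V' [sV' nV' <- <-]] := par u'; have [W' [sW' nW' <- <-]] := par w'.
apply: (@constant_of_is_derive0 _ (fun t => \sum_i
  met (B i) (gamma t) (V t) (W t) * met (B i) (gamma t) (V' t) (W' t)) J IJ)
    => t Jt.
have d i := is_derive_mul
  (is_derive_bilinear_along oJ sg (sB i) (nB i) sV sW Jt)
  (is_derive_bilinear_along oJ sg (sB i) (nB i) sV' sW' Jt).
apply: is_derive_eq (is_derive_sum_pointwise d) _.
rewrite -[RHS](rotation_invariant (e _ (velocity gamma t))
  (fun i => met (B i) (gamma t) (V t) (W t))
  (fun i => met (B i) (gamma t) (V' t) (W' t))).
apply: eq_bigr => i _; rewrite nV// nW// nV'// nW'// !met0l !met0r !add0r.
by rewrite !met_rotation.
Qed.

End BilinearForms.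

(** * Covariant derivatives of wedge products *)

Section CovariantDerivativesOfForms.
Variables (R : realType) (m : nat) (M : manifold R m) (D : connection M).

(* [dw p v] is the form (nabla_v w)_p. *)
Definition form_nabla k (w : kform M k)
    (dw : forall p : M, tangent p -> ('I_k -> tangent p) -> R) : Prop :=
  forall U (Y : 'I_k -> vfield M) p (v : tangent p), open U -> U p ->
    (forall i, smooth_vf U (Y i)) ->
    smooth_fun U (fun q => w q (fun i => Y i q)) /\
    nabla_form D w p v Y = dw p v (fun i => Y i p).

(** This is the Leibniz rule, checked separately for each permutation in the definition of
    [wedge]. *)
Lemma wedge_nabla k l (a : kform M k) (b : kform M l) da db :
  form_nabla a da -> form_nabla b db ->
  form_nabla (wedge a b) (fun p v u =>
    wedge (fun _ : M => da p v) b p u + wedge a (fun _ : M => db p v) p u).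
Proof.
move=> na nb U Y p v oU Up sY.
pose Ya (s : 'S_(k + l)) i := Y (s (lshift l i)).
pose Yb (s : 'S_(k + l)) j := Y (s (rshift k j)).
have sa s : smooth_fun U (fun q => a q (fun i => Ya s i q)).
  exact: (na U (Ya s) p v oU Up (fun i => sY _)).1.
have sb s : smooth_fun U (fun q => b q (fun j => Yb s j q)).
  exact: (nb U (Yb s) p v oU Up (fun i => sY _)).1.
have ea s := (na U (Ya s) p v oU Up (fun i => sY _)).2.
have eb s := (nb U (Yb s) p v oU Up (fun i => sY _)).2.
have sab s := smooth_fun_mul oU (sa s) (sb s).
have sabs (s : 'S_(k + l)) := smooth_fun_mul oU (smooth_fun_cst U ((-1) ^+
  s)) (sab s).
have ssum := smooth_fun_sum (index_enum _) oU sabs.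
split; first exact: smooth_fun_mul oU (smooth_fun_cst U _) ssum.
rewrite /nabla_form /wedge.
rewrite (tderiv_mul v (smooth_fun_cst U _) ssum Up) tderiv_cst mulr0 addr0.
rewrite (tderiv_sum _ v oU sabs Up) -!mulr_sumr -!mulrDr -mulrBr; congr (_ * _).
rewrite exchange_big/= -sumrB -big_split/=; apply: eq_bigr => s _.
rewrite (tderiv_mul v (smooth_fun_cst U _) (sab s) Up) tderiv_cst mulr0 addr0.
rewrite -mulr_sumr -mulrBr -mulrDr; congr (_ * _).
rewrite (tderiv_mul v (sa s) (sb s) Up).
(* The slot receiving the covariant derivative is renamed along [s]; the first [k] slots then belong
   to [a] and the last [l] to [b]. *)
rewrite (reindex_inj (@perm_inj _ s))/= big_split_ord/=.
rewrite -[da p v _]ea -[db p v _]eb /nabla_form mulrBl mulrBr.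
rewrite mulr_suml mulr_sumr addrC opprD addrACA.
rewrite addrC; congr (_ - _ + (_ - _)).
- by rewrite mulrC.
- apply: eq_bigr => i _; congr (_ * _).
    congr (a p _); apply/funext => j.
    by rewrite (inj_eq perm_inj) (inj_eq (@lshift_inj _ _)).
  congr (b p _); apply/funext => j.
  by rewrite (inj_eq perm_inj) eq_rlshift.
- apply: eq_bigr => i _; congr (_ * _).
    congr (a p _); apply/funext => j.
    by rewrite (inj_eq perm_inj) eq_lrshift.
  congr (b p _); apply/funext => j.
  by rewrite (inj_eq perm_inj) (inj_eq (@rshift_inj _ _)).
Qed.

Lemma cov_form_nabla (a : covfield M) (da : forall p : M, tangent p ->
  'rV[R]_m) :
  smooth_cov setT a ->
  (forall U Y p (v : tangent p), open U -> U p -> smooth_vf U Y ->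
    tderiv p v (fun q => cov a q (Y q)) =
    cov a p (D v Y) + cov (fun=> da p v) p (Y p)) ->
  form_nabla (form_of_cov a) (fun p v u => cov (fun=> da p v) p (u ord0)).
Proof.
move=> sa na U Y p v oU Up sY; split; first exact: sa.
by rewrite /nabla_form /form_of_cov (na U)// big_ord1 eqxx addrAC subrr add0r.
Qed.

Lemma bilinear_form_nabla (B : endfield M) dB :
  smooth_bilinear B -> bilinear_nabla D B dB ->
  form_nabla (form_of_bilin (met B))
    (fun p v u => met (fun=> dB p v) p (u ord0) (u ord_max)).
Proof.
move=> sB nB U Y p v oU Up sY; split; first exact: sB.
rewrite /nabla_form /form_of_bilin (nB U)// big_ord_recl big_ord1/=.
have -> : lift ord0 ord0 = ord_max :> 'I_2 by exact: val_inj.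
by rewrite addrAC subrr add0r.
Qed.

End CovariantDerivativesOfForms.

(** * Explicit wedge products of 1-forms *)

Lemma wedgeDl (R : realType) (m : nat) (M : manifold R m) k l
    (a a' : kform M k) (b : kform M l) (p : M) (v : 'I_(k + l) -> tangent p) :
  wedge (fun=> (fun u => a p u + a' p u)) b p v =
  wedge a b p v + wedge a' b p v.
Proof.
rewrite /wedge -mulrDr -big_split; congr (_ * _); apply: eq_bigr => s _.
by rewrite mulrDl mulrDr.
Qed.

Lemma det3 (R : comRingType) (a : 'M[R]_3) : \det a =
  a 0 0 * (a 1 1 * a 2%:R 2%:R - a 1 2%:R * a 2%:R 1)
  - a 0 1 * (a 1 0 * a 2%:R 2%:R - a 1 2%:R * a 2%:R 0)
  + a 0 2%:R * (a 1 0 * a 2%:R 1 - a 1 1 * a 2%:R 0).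
Proof.
rewrite (expand_det_row _ 0) sum_ord3 /cofactor.
rewrite !(expand_det_row _ ord0) !big_ord_recl !big_ord0 /cofactor !det_mx11
  !mxE.
(* Indexing the entries by natural numbers makes differently built but equal ordinals the same term
   for [ring]. *)
pose f i j := a (inord i) (inord j).
have af i j : a i j = f i j by rewrite /f !inord_val.
rewrite !af /= /bump/=. ring.
Qed.

Lemma det2 (R : comRingType) (a : 'M[R]_2) :
  \det a = a 0 0 * a 1 1 - a 0 1 * a 1 0.
Proof.
rewrite !(expand_det_row _ ord0) !big_ord_recl !big_ord0 /cofactor !det_mx11
  !mxE.
pose f i j := a (inord i) (inord j).
have af i j : a i j = f i j by rewrite /f !inord_val.
rewrite !af /= /bump/=; ring.
Qed.

Lemma wedge11E (R : realType) (m : nat) (M : manifold R m) (a b : kform M 1)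
    (p : M) (v : 'I_(1 + 1) -> tangent p) :
  wedge a b p v = a p (fun=> v 0) * b p (fun=> v 1)
                - a p (fun=> v 1) * b p (fun=> v 0).
Proof.
pose A : 'M[R]_2 := \matrix_(i, j)
  (if i == 0 then a p (fun=> v j) else b p (fun=> v j)).
have := det2 A; rewrite !mxE/= => <-.
rewrite /wedge mul1n invr1 mul1r /determinant; apply: eq_bigr => s _.
rewrite !big_ord_recl big_ord0 mulr1 !mxE/=; congr (_ * (_ * _)).
- by congr (a p _); apply/funext => i; rewrite (ord1 i); congr (v (s _));
  exact: val_inj.
- by congr (b p _); apply/funext => i; rewrite (ord1 i); congr (v (s _));
  exact: val_inj.
Qed.

(** Expanding the inner wedge gives two sums over permutations. The first is the determinant of the
    values; the second has its first two arguments exchanged by a transposition and is minus the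
    determinant. Their difference is twice the determinant, which the factor 1/2 in the outer wedge
    cancels. *)
Lemma wedge21E (R : realType) (m : nat) (M : manifold R m) (a b c : kform M 1)
    (p : M) (v : 'I_(1 + 1 + 1) -> tangent p) :
  wedge (wedge a b) c p v =
  let A i := a p (fun=> v i) in let B i := b p (fun=> v i) in
  let C i := c p (fun=> v i) in
    A 0 * (B 1 * C 2%:R - B 2%:R * C 1)
    - A 1 * (B 0 * C 2%:R - B 2%:R * C 0)
    + A 2%:R * (B 0 * C 1 - B 1 * C 0).
Proof.
pose A i := a p (fun=> v i); pose B i := b p (fun=> v i).
pose C i := c p (fun=> v i); rewrite -/A -/B -/C.
pose F : 'M[R]_3 := \matrix_(i, j)
  (if i == 0 then A j else if i == 1 then B j else C j).
have := det3 F; rewrite !mxE/= => <-.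
have prod3 (f : 'I_3 -> R) : \prod_i f i = f 0 * f 1 * f 2%:R.
  rewrite !big_ord_recl big_ord0 mulr1 mulrA.
  by congr (_ * f _ * f _); exact: val_inj.
have detE : \det F = \sum_(s : 'S_3) (-1) ^+ s * (A (s 0) * B (s 1)
  * C (s 2%:R)).
  by apply: eq_bigr => s _; rewrite prod3 !mxE.
have swapE : \sum_(s : 'S_3) (-1) ^+ s * (A (s 1) * B (s 0) * C (s 2%:R)) =
  - \det F.
  rewrite detE -sumrN (reindex_inj (mulgI (tperm 0 1))).
  apply: eq_bigr => s _.
  rewrite odd_mul_tperm/= signrN mulNr !permM tpermL tpermR tpermD//.
have h2 : (2 : R) != 0 by rewrite pnatr_eq0.
apply: (mulfI h2); rewrite [RHS]mulrDl mul1r -{2}[\det F]opprK -swapE detE.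
rewrite {1}/wedge muln1 mulrA mulfV// mul1r -sumrB.
apply: eq_bigr => s _; rewrite -mulrBr wedge11E mulrBl.
have e0 : lshift 1 0 = 0 :> 'I_(2 + 1) by exact: val_inj.
have e1 : lshift 1 1 = 1 :> 'I_(2 + 1) by exact: val_inj.
have e2 (j : 'I_1) : rshift 2 j = 2%:R :> 'I_(2 + 1) by rewrite (ord1 j);
  exact: val_inj.
rewrite e0 e1 (_ : (fun j => v (s (rshift 2 j))) = fun=> v (s 2%:R))//.
by apply/funext => j; rewrite e2.
Qed.

(** * Almost 3-contact structures *)

Section Covectors.
Variables (R : realType) (m : nat) (M : manifold R m).
Implicit Types (a : covfield M) (p : M).

Lemma covD a p (u v : tangent p) : cov a p (u + v) = cov a p u + cov a p v.
Proof. by rewrite /cov mulmxDr mxE. Qed.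

Lemma covZ a p b (u : tangent p) : cov a p (b *: u) = b * cov a p u.
Proof. by rewrite /cov -scalemxAr mxE. Qed.

Lemma covN a p (u : tangent p) : cov a p (- u) = - cov a p u.
Proof. by rewrite -scaleN1r covZ mulN1r. Qed.

Lemma cov0 a p : cov a p 0 = 0.
Proof. by rewrite -(scale0r 0) covZ mul0r. Qed.

Lemma cov_sum a p n (u : 'I_n -> tangent p) :
  cov a p (\sum_i u i) = \sum_i cov a p (u i).
Proof. by apply: (big_morph (cov a p)) => [x y|]; rewrite ?covD ?cov0. Qed.

Lemma cov_rotation a a' (b c : R) p (u : tangent p) :
  cov (fun=> b *: a p - c *: a' p) p u = b * cov a p u - c * cov a' p u.
Proof. by rewrite /cov mulmxBl -!scalemxAl !mxE. Qed.

Lemma mulmx_cov (x : 'cV[R]_m) a p (u : tangent p) :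
  x *m (a p *m u) = cov a p u *: x.
Proof. by rewrite [a p *m u]mx11_scalar mul_mx_scalar. Qed.

End Covectors.

Section AlmostContactAlgebra.
Variables (R : realType) (m : nat) (M : manifold R m).
Variables (phi : endfield M) (xi : vfield M) (eta : covfield M)
  (g : endfield M).
Hypothesis ac : almost_contact_metric phi xi eta g.
Implicit Types p : M.

Lemma met_sym p (u v : tangent p) : met g p u v = met g p v u.
Proof.
have [[_ _ _ [gT _ _]] _ _ _] := ac.
have e : (u^T *m g p *m v)^T = v^T *m g p *m u.
  by rewrite !trmx_mul trmxK gT mulmxA.
by rewrite /met -e [in RHS]mxE.
Qed.

Lemma met_eq0 p (u : tangent p) : met g p u u = 0 -> u = 0.
Proof.
have [[_ _ _ [_ gpos _]] _ _ _] := ac => gu.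
by apply/eqP; apply: contraPT gu => /gpos; rewrite lt0r => /andP[/eqP].
Qed.

Lemma met_inj p (u v : tangent p) :
  (forall w : tangent p, met g p w u = met g p w v) -> u = v.
Proof.
move=> uv; apply/eqP; rewrite -subr_eq0; apply/eqP/(@met_eq0 p).
by rewrite metDr metNr uv subrr.
Qed.

Lemma phi2 p (v : tangent p) :
  phi p *m (phi p *m v) = - v + cov eta p v *: xi p.
Proof.
have [_ /(_ p) pp _ _] := ac.
by rewrite mulmxA pp mulmxDl mulNmx mul1mx -mulmxA mulmx_cov.
Qed.

Lemma eta_xi1 p : cov eta p (xi p) = 1.
Proof. by have [_ _ ex _] := ac. Qed.

(** As [phi] squared kills [xi], applying the formula for [phi] squared to [phi xi] shows that
    [phi xi = a xi]. Then [phi] squared maps [xi] to [a ^ 2 xi = 0], which forces [a = 0]. *)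
Lemma phi_xi p : phi p *m xi p = 0.
Proof.
have [a phixi] : exists a, phi p *m xi p = a *: xi p.
  exists (cov eta p (phi p *m xi p)).
  have := @phi2 p (phi p *m xi p).
  rewrite (@phi2 p (xi p)) eta_xi1 scale1r addNr mulmx0.
  by move/esym/eqP; rewrite addrC subr_eq0 => /eqP.
have := @phi2 p (xi p); rewrite eta_xi1 scale1r addNr phixi -scalemxAr phixi
  scalerA.
move/(congr1 (cov eta p)); rewrite covZ eta_xi1 mulr1 cov0.
by move/eqP; rewrite mulf_eq0 orbb => /eqP ->; rewrite scale0r.
Qed.

(** The cube of [phi] is computed in two ways, as [phi] after its square and as the square after
    [phi]; only the latter has the term [eta (phi v) xi]. *)
Lemma eta_phi p (v : tangent p) : cov eta p (phi p *m v) = 0.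
Proof.
have := congr1 (mulmx (phi p)) (@phi2 p v).
rewrite (@phi2 p (phi p *m v)) mulmxDr mulmxN -scalemxAr phi_xi scaler0 addr0.
move/(congr1 (cov eta p)); rewrite covD covZ eta_xi1 mulr1 covN.
by move/eqP; rewrite -subr_eq0 opprK addrAC addNr add0r => /eqP.
Qed.

Lemma met_xi p (u : tangent p) : met g p u (xi p) = cov eta p u.
Proof.
have [_ _ _ /(_ p u (xi p))] := ac.
rewrite phi_xi met0r eta_xi1 mulr1 => /esym/eqP.
by rewrite subr_eq0 => /eqP.
Qed.

Lemma phi_skew p (u v : tangent p) :
  met g p (phi p *m u) v = - met g p u (phi p *m v).
Proof.
have [_ _ _ /(_ p u (phi p *m v))] := ac.
rewrite eta_phi mulr0 subr0 phi2 metDr metZr met_xi eta_phi mulr0 addr0 metNr.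
by move=> <-; rewrite opprK.
Qed.

End AlmostContactAlgebra.

(** Translation by [i] modulo 3 has trivial cube, and a permutation has the parity of its cube. *)
Lemma even_triple_cyclic (i : 'I_3) : even_triple i (i + 1) (i + 2%:R).
Proof.
pose s := perm (addrI i); exists s; rewrite !permE addr0; split=> //.
have : (s * s * s)%g = 1%g.
  apply/permP => x; rewrite !permM !permE !addrA.
  by elim/ord3P: i {s} => //; rewrite !add_ord3.
move/(congr1 (@odd_perm _)); rewrite !odd_permM odd_perm1.
by case: (odd_perm s).
Qed.

Lemma ord3_shiftP (P : 'I_3 -> Prop) (i : 'I_3) :
  P i -> P (i + 1) -> P (i + 2%:R) -> forall j, P j.
Proof.
move=> P0 P1 P2 j; rewrite -(subrKC i j).
by elim/ord3P: (j - i) => //; rewrite addr0.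
Qed.

Section Almost3ContactAlgebra.
Variables (R : realType) (m : nat) (M : manifold R m).
Variables (phi : 'I_3 -> endfield M) (xi : 'I_3 -> vfield M)
  (eta : 'I_3 -> covfield M) (g : endfield M).
Hypothesis acm3 : almost_3contact_metric phi xi eta g.
Implicit Types (p : M) (i j : 'I_3).

Let ac i := acm3.1 i.

Lemma phi_xi_next i p : phi i p *m xi (i + 1) p = xi (i + 2%:R) p.
Proof. by have [_ [-> _] _] := acm3.2 _ _ _ (even_triple_cyclic i) p. Qed.

Lemma addi21 i : i + 2%:R + 1 = i.
Proof. by rewrite -addrA add_ord3 addr0. Qed.

Lemma addi22 i : i + 2%:R + 2%:R = i + 1.
Proof. by rewrite -addrA add_ord3. Qed.

Lemma addi11 i : i + 1 + 1 = i + 2%:R.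
Proof. by rewrite -addrA add_ord3. Qed.

Lemma addi12 i : i + 1 + 2%:R = i.
Proof. by rewrite -addrA add_ord3 addr0. Qed.

Lemma phi_xi_prev i p : phi i p *m xi (i + 2%:R) p = - xi (i + 1) p.
Proof.
have [_ [_]] := acm3.2 _ _ _ (even_triple_cyclic (i + 2%:R)) p.
by rewrite addi21 addi22 => -> _; rewrite opprK.
Qed.

Lemma eta_phi_next i p (v : tangent p) :
  cov (eta (i + 1)) p (phi i p *m v) = - cov (eta (i + 2%:R)) p v.
Proof.
have [_ _ [_ e]] := acm3.2 _ _ _ (even_triple_cyclic i) p.
by rewrite /cov e mulNmx mulmxA; set X := _ *m v; rewrite [(- X) 0 0]mxE opprK.
Qed.

Lemma eta_phi_prev i p (v : tangent p) :
  cov (eta (i + 2%:R)) p (phi i p *m v) = cov (eta (i + 1)) p v.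
Proof.
have [_ _ [e _]] := acm3.2 _ _ _ (even_triple_cyclic (i + 2%:R)) p.
by move: e; rewrite addi21 addi22 /cov => ->; rewrite mulmxA.
Qed.

Lemma phi_phi_next i p (v : tangent p) : phi i p *m (phi (i + 1) p *m v) =
  phi (i + 2%:R) p *m v + cov (eta (i + 1)) p v *: xi i p.
Proof.
have [[e _] _ _] := acm3.2 _ _ _ (even_triple_cyclic i) p.
by rewrite e mulmxBl -!mulmxA mulmx_cov subrK.
Qed.

Lemma phi_next_phi i p (v : tangent p) : phi (i + 1) p *m (phi i p *m v) =
  - (phi (i + 2%:R) p *m v) + cov (eta i) p v *: xi (i + 1) p.
Proof.
have [[_ e] _ _] := acm3.2 _ _ _ (even_triple_cyclic i) p.
by rewrite e mulmxDl mulNmx -!mulmxA mulmx_cov opprD opprK subrK.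
Qed.

(** For [j] different from [i], the vector [xi j] is up to sign in the image of [phi i], on which
    [eta i] vanishes. *)
Lemma eta_xi i j p : cov (eta i) p (xi j p) = (i == j)%:R.
Proof.
move: j.
apply: (@ord3_shiftP (fun j => cov (eta i) p (xi j p) = (i == j)%:R) i).
- by rewrite eqxx (eta_xi1 (ac i)).
- rewrite -[xi (i + 1) p]opprK -phi_xi_prev covN (eta_phi (ac i)) oppr0.
  by elim/ord3P: i.
- rewrite -phi_xi_next (eta_phi (ac i)).
  by elim/ord3P: i.
Qed.

End Almost3ContactAlgebra.

(** * The canonical connection *)

Section CanonicalConnection.
Variables (R : realType) (m : nat) (M : manifold R m).
Variables (phi : 'I_3 -> endfield M) (xi : 'I_3 -> vfield M)
  (eta : 'I_3 -> covfield M) (g : endfield M).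
Variables (beta : M -> R) (D : connection M).
Hypothesis acm3 : almost_3contact_metric phi xi eta g.
Hypothesis can_nabla : canonical_connection phi eta g beta D.
Implicit Types (U : set M) (p : M) (i j : 'I_3) (Y Z : vfield M).

Let ac i := acm3.1 i.

Definition fundamental_mx i : endfield M := fun p => g p *m phi i p.

Lemma met_fundamental_mx i p (u w : tangent p) :
  met (fundamental_mx i) p u w = met g p u (phi i p *m w).
Proof. by rewrite /met !mulmxA. Qed.

(** Up to sign, the angular velocity of the common rotation of the triples when moving along [v]. *)
Definition rotation_rate p (v : tangent p) i := beta p * cov (eta i) p v.

Lemma smooth_metric : smooth_bilinear g.
Proof. by have [[_ _ _ [_ _]]] := ac 0. Qed.

Lemma smooth_ap_phi i U Y : open U -> smooth_vf U Y ->
  smooth_vf U (ap (phi i) Y).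
Proof. by move=> oU; have [[sphi _ _ _] _ _ _] := ac i; exact: sphi. Qed.

Lemma smooth_xi i U : smooth_vf U (xi i).
Proof.
by have [[_ sxi _ _] _ _ _] := ac i; exact: smooth_vf_sub sxi.
Qed.

Lemma smooth_fundamental_mx i : smooth_bilinear (fundamental_mx i).
Proof.
move=> U X Y oU sX sY.
apply: smooth_fun_eq (smooth_metric oU sX (smooth_ap_phi i oU sY)) => // p _.
by rewrite met_fundamental_mx.
Qed.

Lemma nabla_phi i U Y p (v : tangent p) : open U -> U p -> smooth_vf U Y ->
  D v (ap (phi i) Y) = phi i p *m D v Y
    + rotation_rate v (i + 2%:R) *: (phi (i + 1) p *m Y p)
    - rotation_rate v (i + 1) *: (phi (i + 2%:R) p *m Y p).
Proof.
move=> oU Up sY; have [_ _ _] := can_nabla.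
move=> /(_ _ _ _ (even_triple_cyclic i) U Y p v oU Up sY)/eqP.
rewrite subr_eq => /eqP->.
by rewrite addrC -addrA scalerBr !scalerA.
Qed.

Lemma metric_nabla : bilinear_nabla D g (fun _ _ => 0).
Proof.
move=> U Y Z p v oU Up sY sZ; have [_ mD _ _] := can_nabla.
by rewrite (mD U)// met_zero addr0.
Qed.

Lemma fundamental_nabla i :
  bilinear_nabla D (fundamental_mx i) (fun p v =>
    rotation_rate v (i + 2%:R) *: fundamental_mx (i + 1) p
    - rotation_rate v (i + 1) *: fundamental_mx (i + 2%:R) p).
Proof.
move=> U Y Z p v oU Up sY sZ.
rewrite (tderiv_eq v oU (g := fun q => met g q (Y q) (ap (phi i) Z q)) _ Up);
  last first.
  by move=> q _; rewrite met_fundamental_mx.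
rewrite (metric_nabla v oU Up sY (smooth_ap_phi i oU sZ)).
rewrite (nabla_phi i v oU Up sZ) met_rotation !met_fundamental_mx.
rewrite !metDr metNr !metZr met_zero.
by rewrite addr0 !addrA.
Qed.

(** Differentiating [phi i (xi i) = 0] determines [phi i] of the derivative of [xi i]. That
    derivative lies in the kernel of [eta i] because [xi i] has unit length, and there applying
    [phi i] once more recovers it up to sign. *)
Lemma nabla_xi i p (v : tangent p) : D v (xi i) =
  rotation_rate v (i + 2%:R) *: xi (i + 1) p
  - rotation_rate v (i + 1) *: xi (i + 2%:R) p.
Proof.
have oT := @openT M; have sxi := @smooth_xi i setT.
have [[_ _ leibniz local _] _ _ _] := can_nabla.
(* The zero field is written as the constant function 0 times [xi i], so that the Leibniz rule gives
   its derivative. *)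
have D0 : D v (ap (phi i) (xi i)) = 0.
  rewrite (local setT _ (fun q => (cst 0 : M -> R) q *: xi i q))//.
  - rewrite (leibniz setT)//; last exact: smooth_fun_cst.
    by rewrite tderiv_cst !scale0r addr0.
  - exact: smooth_ap_phi.
  - exact: smooth_vf_scale oT (smooth_fun_cst _ _) sxi.
  - by move=> q _; rewrite /ap (phi_xi (ac i)) scale0r.
have eta0 : cov (eta i) p (D v (xi i)) = 0.
  have := metric_nabla v oT I sxi sxi.
  rewrite met_zero addr0.
  rewrite [met g p (xi i p) _](met_sym (ac i)) (met_xi (ac i)) -mulr2n.
  rewrite (tderiv_eq v oT (g := cst 1))//; last first.
    by move=> q _; rewrite (met_xi (ac i)) (eta_xi1 (ac i)).
  by rewrite tderiv_cst => /esym/eqP; rewrite mulrn_eq0 => /eqP.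
have := @phi2 _ _ _ _ _ _ _ (ac i) p (D v (xi i)).
rewrite eta0 scale0r addr0.
have := nabla_phi i v oT I sxi; rewrite D0.
have -> : phi (i + 1) p *m xi i p = - xi (i + 2%:R) p.
  by have := phi_xi_prev acm3 (i + 1) p; rewrite addi12 addi11.
have -> : phi (i + 2%:R) p *m xi i p = xi (i + 1) p.
  by have := phi_xi_next acm3 (i + 2%:R) p; rewrite addi21 addi22.
move/eqP; rewrite eq_sym -addrA addr_eq0 => /eqP ->.
rewrite opprD opprK scalerN opprK mulmxDr -!scalemxAr.
rewrite (phi_xi_next acm3) (phi_xi_prev acm3) scalerN => /eqP.
by rewrite -eqr_oppLR opprD opprK addrC => /eqP <-.
Qed.

Lemma eta_nabla i U Y p (v : tangent p) : open U -> U p -> smooth_vf U Y ->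
  tderiv p v (fun q => cov (eta i) q (Y q)) = cov (eta i) p (D v Y)
  + cov (fun=> rotation_rate v (i + 2%:R) *: eta (i + 1) p
               - rotation_rate v (i + 1) *: eta (i + 2%:R) p) p (Y p).
Proof.
move=> oU Up sY.
rewrite (tderiv_eq v oU (g := fun q => met g q (Y q) (xi i q)) _ Up);
  last first.
  by move=> q _; rewrite (met_xi (ac i)).
rewrite (metric_nabla v oU Up sY (@smooth_xi i U)) nabla_xi.
rewrite met_zero addr0 metDr metNr !metZr.
rewrite (met_xi (ac i)) (met_xi (ac (i + 1))) (met_xi (ac (i + 2%:R))).
by rewrite cov_rotation addrA.
Qed.

(** This is the vertical part of the metric. *)
Definition vertical_mx : endfield M := fun p => \sum_i (eta i p)^T *m eta i p.

Lemma met_vertical_mx p (u w : tangent p) :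
  met vertical_mx p u w = \sum_i cov (eta i) p u * cov (eta i) p w.
Proof.
rewrite /met mulmx_sumr mulmx_suml summxE; apply: eq_bigr => i _.
by rewrite mulmxA -mulmxA -trmx_mul mxE big_ord1 [_^T _ _]mxE.
Qed.

Lemma smooth_cov_eta i U Y : open U -> smooth_vf U Y ->
  smooth_fun U (fun p => cov (eta i) p (Y p)).
Proof. by move=> oU; have [[_ _ seta _] _ _ _] := ac i; exact: seta. Qed.

Lemma smooth_vertical_mx : smooth_bilinear vertical_mx.
Proof.
move=> U X Y oU sX sY.
have s i := smooth_fun_mul oU (smooth_cov_eta i oU sX) (smooth_cov_eta i oU sY).
apply: smooth_fun_eq (smooth_fun_sum (index_enum _) oU s) => // p _.
by rewrite met_vertical_mx.
Qed.

Lemma vertical_nabla : bilinear_nabla D vertical_mx (fun _ _ => 0).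
Proof.
move=> U Y Z p v oU Up sY sZ.
have s i := smooth_fun_mul oU (smooth_cov_eta i oU sY) (smooth_cov_eta i oU sZ).
rewrite (tderiv_eq v oU (g := fun q => \sum_i cov (eta i) q (Y q)
  * cov (eta i) q (Z q)) _ Up);
  last by move=> q _; rewrite met_vertical_mx.
rewrite (tderiv_sum _ v oU s Up).
rewrite met_zero !met_vertical_mx.
rewrite -[X in _ = _ + X](rotation_invariant (rotation_rate v) (fun i =>
  cov (eta i) p (Y p))
  (fun i => cov (eta i) p (Z p))).
rewrite -!big_split/=; apply: eq_bigr => i _.
rewrite (tderiv_mul v (smooth_cov_eta i oU sY) (smooth_cov_eta i oU sZ) Up).
rewrite !(eta_nabla i v oU Up)//.
rewrite !cov_rotation; ring.
Qed.

(** Differentiating one factor replaces it by a combination of the other two, so every resulting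
    triple product repeats a factor and vanishes. *)
Lemma parallel_eta123 : parallel_form D (eta123 eta).
Proof.
move=> U Y p v oU Up sY.
have n i := @cov_form_nabla _ _ _ D (eta i) (fun p v =>
  rotation_rate v (i + 2%:R) *: eta (i + 1) p
  - rotation_rate v (i + 1) *: eta (i + 2%:R) p)
  (fun V X oV _ sX => smooth_cov_eta i oV sX) (@eta_nabla i).
have [_ ->] := wedge_nabla (wedge_nabla (n 0) (n 1)) (n 2%:R) v oU Up sY.
rewrite wedgeDl !wedge21E /= /form_of_cov !cov_rotation !add_ord3; ring.
Qed.

Lemma parallel_Psi : parallel_form D (Psi phi g).
Proof.
move=> U Y p v oU Up sY.
have nF i := bilinear_form_nabla (smooth_fundamental_mx i)
  (@fundamental_nabla i).
have n i := wedge_nabla (nF i) (nF i).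
have PsiE (q : M) (u : 'I_(2 + 2) -> tangent q) : Psi phi g u = \sum_i
    wedge (form_of_bilin (met (fundamental_mx i)))
          (form_of_bilin (met (fundamental_mx i))) q u.
  apply: eq_bigr => i _; rewrite /wedge /fundamental_form /form_of_bilin /Phi.
  by under [in RHS]eq_bigr do rewrite !met_fundamental_mx.
have sW i := (n i U Y p v oU Up sY).1.
rewrite /nabla_form; under eq_bigr do rewrite PsiE.
rewrite (tderiv_eq v oU (fun q _ => PsiE q _) Up) (tderiv_sum _ v oU sW Up).
rewrite exchange_big -sumrB.
apply: etrans (eq_bigr _ (fun i _ => (n i U Y p v oU Up sY).2)) _.
rewrite /wedge.
under eq_bigr do rewrite -mulrDr -big_split/=.
(* For each permutation [s] separately, the sum over [i] is the derivative of a scalar product of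
   two equally rotated triples, the values of the [Phi_i] on two pairs of vectors. *)
rewrite -mulr_sumr exchange_big/= big1 ?mulr0// => s _.
under eq_bigr do rewrite -mulrDr.
rewrite -mulr_sumr.
under eq_bigr do rewrite !met_rotation.
by rewrite /form_of_bilin rotation_invariant mulr0.
Qed.

(** * Sections of the bundle spanned by the [phi i] *)

Lemma nabla_combination U (f : 'I_3 -> M -> R) (Z : 'I_3 -> vfield M) p
    (v : tangent p) : open U -> U p ->
  (forall i, smooth_fun U (f i)) -> (forall i, smooth_vf U (Z i)) ->
  D v (fun q => \sum_i f i q *: Z i q) =
  \sum_i (tderiv p v (f i) *: Z i p + f i p *: D v (Z i)).
Proof.
move=> oU Up sf sZ; have [[_ Dadd leibniz local _] _ _ _] := can_nabla.
have s i := smooth_vf_scale oU (sf i) (sZ i).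
have s01 := smooth_vf_add oU (s 0) (s 1).
pose Z' : vfield M := fun q => f 0 q *: Z 0 q + f 1 q *: Z 1 q +
  f 2%:R q *: Z 2%:R q.
have sZ' : smooth_vf U Z' := smooth_vf_add oU s01 (s 2%:R).
rewrite (local U _ Z' p v oU Up (smooth_vf_sum oU s) sZ').
  rewrite (Dadd U _ _ p v oU Up s01 (s 2%:R)) (Dadd U _ _ p v oU Up (s 0)
    (s 1)).
  rewrite (leibniz U _ _ p v oU Up (sf 0) (sZ 0)).
  rewrite (leibniz U _ _ p v oU Up (sf 1) (sZ 1)).
  by rewrite (leibniz U _ _ p v oU Up (sf 2%:R) (sZ 2%:R)) sum_ord3.
by move=> q _; rewrite sum_ord3.
Qed.

(** Vertical vectors single out the coefficient of [phi i]: it maps [xi (i + 1)] to [xi (i + 2%:R)],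
    while the other two endomorphisms map it to vectors orthogonal to [xi (i + 2%:R)]. The
    coefficients of a smooth section are thereby smooth functions. *)
Definition upsilon_coef (F : endfield M) i p : R :=
  met g p (F p *m xi (i + 1) p) (xi (i + 2%:R) p).

Lemma upsilon_coefE (F : endfield M) (a : 'I_3 -> R) p :
  F p = \sum_i a i *: phi i p -> forall i, upsilon_coef F i p = a i.
Proof.
move=> Fp i; rewrite /upsilon_coef Fp (met_xi (ac _)) mulmx_suml cov_sum.
rewrite (bigD1 i)//= big1 => [|j ji].
  rewrite addr0 -scalemxAl covZ (phi_xi_next acm3) (eta_xi acm3) eqxx.
  by rewrite mulr1.
rewrite -scalemxAl covZ; apply/eqP; rewrite mulf_eq0; apply/orP; right.
move: j ji; apply: (@ord3_shiftP (fun j => j != i -> _ == 0) i) => [/eqP//|_|_].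
  by rewrite (phi_xi (ac _)) cov0.
by rewrite (eta_phi (ac _)).
Qed.

Lemma upsilon_nabla U (F : endfield M) Y p (v : tangent p) :
  open U -> U p -> smooth_vf U Y -> upsilon_section phi U F ->
  nabla_end D F p v Y = (\sum_i
    (tderiv p v (upsilon_coef F i)
     + upsilon_coef F (i + 2%:R) p * rotation_rate v (i + 1)
     - upsilon_coef F (i + 1) p * rotation_rate v (i +
       2%:R)) *: phi i p) *m Y p.
Proof.
move=> oU Up sY [sF FE]; have sxi i := @smooth_xi i U.
have sa i : smooth_fun U (upsilon_coef F i).
  exact: smooth_metric oU (sF U _ oU (@subset_refl _ U) (sxi _)) (sxi _).
have Fa q : U q -> F q = \sum_i upsilon_coef F i q *: phi i q.
  move=> Uq; have [a Fqa] := FE q Uq; rewrite {1}Fqa.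
  by apply: eq_bigr => i _; rewrite (upsilon_coefE Fqa).
have sphi i := smooth_ap_phi i oU sY.
have [[_ _ _ local _] _ _ _] := can_nabla.
rewrite /nabla_end.
(* [F] is known to be this combination over [U] only, so the two fields are exchanged by locality of
   the connection. *)
have -> : D v (ap F Y) = D v (fun q => \sum_i upsilon_coef F i q *: ap (phi i)
  Y q).
  have sFY := sF U Y oU (@subset_refl _ U) sY.
  have sS := smooth_vf_sum oU (fun i => smooth_vf_scale oU (sa i) (sphi i)).
  apply: (local U _ _ p v oU Up sFY sS) => q Uq;
    rewrite /ap {1}(Fa q Uq) mulmx_suml.
  by apply: eq_bigr => i _; rewrite -scalemxAl.
rewrite (nabla_combination v oU Up sa sphi).
under eq_bigr do rewrite (nabla_phi _ v oU Up sY).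
rewrite (Fa p Up) !sum_ord3 !add_ord3.
rewrite !mulmxDl -!scalemxAl /ap.
move: (phi 0 p *m _) (phi 1 p *m _) (phi 2%:R p *m _) => z0 z1 z2.
move: (phi 0 p *m _) (phi 1 p *m _) (phi 2%:R p *m _) => y0 y1 y2.
apply/colP => k; rewrite !mxE; ring.
Qed.

Lemma canonical_preserves_upsilon : preserves_upsilon phi D.
Proof.
move=> U X F oU sX uF; exists (fun p => \sum_i
    (tderiv p (X p) (upsilon_coef F i)
     + upsilon_coef F (i + 2%:R) p * rotation_rate (X p) (i + 1)
     - upsilon_coef F (i + 1) p * rotation_rate (X p) (i + 2%:R)) *: phi i p).
have nG V Y p : open V -> V `<=` U -> V p -> smooth_vf V Y ->
    nabla_end D F p (X p) Y = (\sum_i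
    (tderiv p (X p) (upsilon_coef F i)
     + upsilon_coef F (i + 2%:R) p * rotation_rate (X p) (i + 1)
     - upsilon_coef F (i + 1) p * rotation_rate (X p) (i +
       2%:R)) *: phi i p) *m Y p.
  move=> oV VU Vp sY; apply: (upsilon_nabla _ oV Vp sY).
  split=> [W Z oW WV sZ|q Vq]; last exact: uF.2 _ (VU _ Vq).
  by apply: uF.1 => //; exact: subset_trans VU.
split; last exact: nG.
split=> [V Y oV VU sY|p Up]; last by eexists.
have [[_ _ _ _ sD] _ _ _] := can_nabla.
have sXV := smooth_vf_sub VU sX.
have sFY := uF.1 V Y oV VU sY.
have sFDY := uF.1 V _ oV VU (sD V X Y oV sXV sY).
(* Smoothness of the new section is not read off its coefficients: applied to [Y] it is the
   derivative of [F Y] minus [F] of the derivative of [Y], both smooth. *)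
apply: smooth_vf_eq (smooth_vf_add oV (sD V X _ oV sXV sFY)
  (smooth_vf_opp oV sFDY)) => //.
by move=> p Vp; exact: (nG V Y p oV VU Vp sY).
Qed.
End CanonicalConnection.

(** * The stabilizer of the parallel tensors *)

Section Stabilizer.
Variables (R : realType) (m : nat) (M : manifold R m).
Variables (phi : 'I_3 -> endfield M) (xi : 'I_3 -> vfield M)
  (eta : 'I_3 -> covfield M) (g : endfield M).
Hypothesis acm3 : almost_3contact_metric phi xi eta g.
Variable p : M.
Implicit Types (i j : 'I_3) (A : 'M[R]_m) (u v w : tangent p).

Let ac i := acm3.1 i.

Lemma sum_ord3_shift (V : nmodType) (f : 'I_3 -> V) j :
  \sum_i f i = f j + f (j + 1) + f (j + 2%:R).
Proof. by rewrite (reindex_inj (addrI j)) sum_ord3 addr0. Qed.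

Definition vertical_proj : 'M[R]_m := \sum_i xi i p *m eta i p.

Lemma vertical_projE u : vertical_proj *m u = \sum_i cov (eta i) p u *: xi i p.
Proof.
rewrite mulmx_suml; apply: eq_bigr => i _.
by rewrite -mulmxA mulmx_cov.
Qed.

Lemma met_vertical_proj u w :
  met g p (vertical_proj *m u) w = \sum_i cov (eta i) p u * cov (eta i) p w.
Proof.
rewrite vertical_projE met_suml; apply: eq_bigr => i _.
by rewrite metZl (met_sym (ac i)) (met_xi (ac i)).
Qed.

Lemma vertical_proj_xi j : vertical_proj *m xi j p = xi j p.
Proof.
rewrite vertical_projE (bigD1 j)//= (eta_xi acm3) eqxx scale1r big1 ?addr0//.
by move=> i ij; rewrite (eta_xi acm3) (negPf ij) scale0r.
Qed.

Lemma vertical_proj_horizontal u : horizontal (p :=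
  p) eta u -> vertical_proj *m u = 0.
Proof.
by move=> hu; rewrite vertical_projE big1// => i _; rewrite hu scale0r.
Qed.

Lemma horizontal_proj u : horizontal (p := p) eta (u - vertical_proj *m u).
Proof.
move=> i; rewrite covD covN vertical_projE cov_sum (bigD1 i)//= big1.
  by rewrite covZ (eta_xi acm3) eqxx mulr1 addr0 subrr.
by move=> j ji; rewrite covZ (eta_xi acm3) eq_sym (negPf ji) mulr0.
Qed.

(* A skew endomorphism preserving both the horizontal and the vertical space:
   the second clause says that A annihilates the tensor sum_i eta_i (x) eta_i.
     *)
Definition block_skew A : Prop := skew_end g p A /\
  forall u v, \sum_i (cov (eta i) p (A *m u) * cov (eta i) p v
                    + cov (eta i) p u * cov (eta i) p (A *m v)) = 0.

Lemma block_skew_comb a A B :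
  block_skew A -> block_skew B -> block_skew (a *: A + B).
Proof.
move=> [sA vA] [sB vB]; split=> u v.
  rewrite !mulmxDl -!scalemxAl metDl metDr metZl metZr sA sB.
  by rewrite opprD mulrN.
have := congr2 (fun x y => a * x + y) (vA u v) (vB u v).
rewrite /= mulr0 addr0; apply: etrans; rewrite mulr_sumr -big_split/=.
apply: eq_bigr => i _; rewrite !mulmxDl -!scalemxAl !covD !covZ; ring.
Qed.

Lemma block_skew0 : block_skew 0.
Proof.
split=> u v; first by rewrite !mul0mx met0l met0r oppr0.
by apply: big1 => i _; rewrite !mul0mx !cov0 mul0r mulr0 addr0.
Qed.

Lemma block_skew_phi j : block_skew (phi j p).
Proof.
split=> u v; first exact: (phi_skew (ac j)).
rewrite (sum_ord3_shift _ j) !(eta_phi (ac j)) !(eta_phi_next acm3).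
rewrite !(eta_phi_prev acm3); ring.
Qed.

Lemma block_skew_phi_comb (a : 'I_3 -> R) : block_skew (\sum_i a i *: phi i p).
Proof.
rewrite sum_ord3 addrC -addrC -addrA -[phi 2%:R p]addr0.
apply: block_skew_comb; first exact: block_skew_phi.
apply: block_skew_comb; first exact: block_skew_phi.
rewrite addr0 -[_ *: _]addr0.
apply: block_skew_comb; [exact: block_skew_phi | exact: block_skew0].
Qed.

(** Skewness of [A] moves it off the projection, [met_vertical_proj] turns the pairing into a sum
    over the [eta i], and the second clause of [block_skew] moves [A] to the other argument. *)
Lemma block_skew_so_V A : block_skew A -> so_V eta g p (A *m vertical_proj).
Proof.
move=> [sA vA]; split=> [u v|v hv]; last first.
  by rewrite -mulmxA vertical_proj_horizontal// mulmx0.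
have r : - met g p u (A *m (vertical_proj *m v)) =
    \sum_i cov (eta i) p (A *m u) * cov (eta i) p v.
  rewrite -sA (met_sym (ac 0)) met_vertical_proj.
  by apply: eq_bigr => i _; rewrite mulrC.
rewrite -!mulmxA r sA met_vertical_proj; apply/esym/eqP.
by rewrite -addr_eq0 -big_split/= vA.
Qed.

Lemma block_skew_so_H A : block_skew A -> so_H xi g p (A *m (1%:M -
  vertical_proj)).
Proof.
move=> bA; have [sV _] := block_skew_so_V bA; split=> [u v|i].
  rewrite mulmxBr mulmx1 !mulmxBl metDl metNl metDr metNr bA.1 sV.
  by rewrite opprD.
by rewrite -mulmxA mulmxBl mul1mx vertical_proj_xi subrr mulmx0.
Qed.

Lemma horizontal_phi i v : horizontal (p := p) eta v -> horizontal (p :=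
  p) eta (phi i p *m v).
Proof.
move=> hv; apply: (@ord3_shiftP _ i).
- exact: (eta_phi (ac i)).
- by rewrite (eta_phi_next acm3) hv oppr0.
- by rewrite (eta_phi_prev acm3) hv.
Qed.

(** The point is skewness of the [sp_1] part, which its definition does not state. That part is a
    combination of the skew [phi i] cut off by the horizontal projection. *)
Lemma sp_n_sp_1_so_V_sub : sp_n_sp_1_so_V phi xi eta g p `<=` so_H_so_V xi eta
  g p.
Proof.
move=> _ [_ [S [sS _] [Q [Qxi [a Qa]] <-]] [B sB <-]].
exists (S + Q); last by exists B.
have [sQ _] := block_skew_so_H (block_skew_phi_comb a).
have QE : Q = (\sum_i a i *: phi i p) *m (1%:M - vertical_proj).
  have Qu (u : 'cV[R]_m) : Q *m u = (\sum_i a i *: phi i p)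
    *m (1%:M - vertical_proj) *m u.
    have hu := horizontal_proj u.
    rewrite -mulmxA mulmxBl mul1mx mulmx_suml.
    under [RHS]eq_bigr do rewrite -scalemxAl.
    rewrite -Qa// mulmxBr vertical_projE mulmx_sumr big1 ?subr0// => i _.
    by rewrite -scalemxAr Qxi scaler0.
  by apply/matrixP => i j; have := Qu (delta_mx j 0);
    rewrite -!colE => /matrixP/(_ i 0); rewrite !mxE.
split=> [u v|i]; last by rewrite mulmxDl sS.2 Qxi addr0.
by rewrite !mulmxDl metDl metDr sS.1 {1 2}QE sQ opprD.
Qed.

(** On horizontal vectors the [phi i] multiply like the imaginary quaternion units, so their
    commutators are twice the third unit up to sign. *)
Lemma commutator_phi_comb (a : 'I_3 -> R) j v : horizontal (p := p) eta v ->
  (\sum_i a i *: phi i p) *m (phi j p *m v)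
  - phi j p *m ((\sum_i a i *: phi i p) *m v) =
  (2 * a (j + 2%:R)) *: (phi (j + 1) p *m v)
  - (2 * a (j + 1)) *: (phi (j + 2%:R) p *m v).
Proof.
move=> hv; have hv' i : cov (eta i) p v = 0 := hv i.
rewrite (sum_ord3_shift _ j) !mulmxDl !mulmxDr -!scalemxAl -!scalemxAr.
have := phi_next_phi acm3 j v; have := phi_phi_next acm3 j v.
have := phi_next_phi acm3 (j + 2%:R) v; have := phi_phi_next acm3 (j + 2%:R) v.
rewrite addi21 addi22 !hv' !scale0r !addr0 => -> -> -> ->.
move: (phi j p *m _) (phi (j + 1) p *m v) (phi (j + 2%:R) p *m v) => x y z.
by apply/colP => k; rewrite !mxE; ring.
Qed.

(* The last hypothesis says that A annihilates the tensor
   sum_i Phi_i (x) Phi_i; evaluated at the vertical vectors it gives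
   [A, phi_j] = sum_i c_ji phi_i with c skew-symmetric. *)
Lemma stabilizer_sub A : skew_end g p A ->
  (forall u v, \sum_i (cov (eta i) p (A *m u) * cov (eta i) p v
                      + cov (eta i) p u * cov (eta i) p (A *m v)) = 0) ->
  (forall u w u' w', let F i u w := met g p u (phi i p *m w) in
    \sum_i ((F i (A *m u) w + F i u (A *m w)) * F i u' w'
          + F i u w * (F i (A *m u') w' + F i u' (A *m w'))) = 0) ->
  sp_n_sp_1_so_V phi xi eta g p A.
Proof.
move=> sA vA FA; pose F i u w := met g p u (phi i p *m w).
pose d i u w := F i (A *m u) w + F i u (A *m w).
(* These pairs of vertical vectors are dual to the [F i]; inserted as [u'], [w'] in the invariance
   of the sum, they isolate the single term [d j]. *)
have Fxi i j : F i (xi (j + 2%:R) p) (xi (j + 1) p) = (i == j)%:R.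
  rewrite /F (met_sym (ac 0)).
  move: i; apply: (@ord3_shiftP _ j).
  - by rewrite (phi_xi_next acm3) (met_xi (ac _)) (eta_xi acm3) !eqxx.
  - rewrite (phi_xi (ac _)) met0l; by elim/ord3P: j.
  - rewrite (met_xi (ac _)) (eta_phi (ac _)); by elim/ord3P: j.
pose c j i := d i (xi (j + 2%:R) p) (xi (j + 1) p).
have dE j u w : d j u w = - \sum_i c j i * F i u w.
  have := FA u w (xi (j + 2%:R) p) (xi (j + 1) p).
  rewrite /= big_split/= (bigD1 j)//= big1 => [|i ij]; last first.
    by rewrite [X in _ * X](Fxi i j) (negPf ij) mulr0.
  rewrite [X in _ * X + _ + _](Fxi j j) eqxx mulr1 addr0.
  move/eqP; rewrite addr_eq0 => /eqP e; rewrite [LHS]e; congr (- _).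
  by apply: eq_bigr => i _; rewrite mulrC.
(* Evaluating [dE] on a dual pair again picks out one coefficient. *)
have cskew j k : c j k = - c k j.
  rewrite {1}/c dE; congr (- _); rewrite (bigD1 j)//=
    Fxi eqxx mulr1 big1 ?addr0//.
  by move=> i ij; rewrite Fxi (negPf ij) mulr0.
have cA j v : A *m (phi j p *m v) - phi j p *m (A *m v) =
    c j (j + 1) *: (phi (j + 1) p *m v) + c j (j + 2%:R) *: (phi (j +
      2%:R) p *m v).
  apply: (met_inj (ac 0) (p := p)) => w.
  rewrite metDr metNr metDr !metZr; have := dE j w v.
  rewrite /d /F sA (sum_ord3_shift _ j) => /eqP.
  have -> : c j j = 0.
    by have /eqP := cskew j j; rewrite -addr_eq0 -mulr2n mulrn_eq0 => /eqP.
  by rewrite mul0r add0r eq_sym eqr_oppLR opprD opprK eq_sym => /eqP.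
(* Chosen so that the combination [Q] has the same commutators with the [phi j] on horizontal
   vectors as [A]; the 2 cancels the factor in [commutator_phi_comb]. *)
pose a i := c (i + 1) (i + 2%:R) / 2.
pose Q := \sum_i a i *: phi i p.
have bA : block_skew A by [].
have bS : block_skew (A - Q).
  rewrite addrC -scaleN1r; apply: block_skew_comb bA;
    exact: block_skew_phi_comb.
(* The [sp_n] and [sp_1] parts are [A - Q] and [Q] on the horizontal space; the [so_V] part is [A]
   on the vertical one. *)
exists ((A - Q) *m (1%:M - vertical_proj) + Q *m (1%:M - vertical_proj)).
  exists ((A - Q) *m (1%:M - vertical_proj)).
    split; first exact: block_skew_so_H.
    move=> j v hv; have hjv := horizontal_phi j hv.
    rewrite -!mulmxA !mulmxBl !mul1mx !vertical_proj_horizontal// !subr0.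
    have e : A *m (phi j p *m v) - phi j p *m (A *m v) =
        Q *m (phi j p *m v) - phi j p *m (Q *m v).
      rewrite cA commutator_phi_comb// /a addi22 addi21 addi11 addi12.
      have half (x : R) : 2 * (x / 2) = x by field.
      by rewrite !half [c (j + 2%:R) j]cskew scaleNr opprK.
    move/eqP: e; rewrite mulmxBr subr_eq => /eqP ->.
    by rewrite addrAC [_ - _ - _]addrAC subrr add0r addrC.
  exists (Q *m (1%:M - vertical_proj)) => //.
  split=> [i|]; first by rewrite -mulmxA mulmxBl mul1mx vertical_proj_xi subrr
    mulmx0.
  exists a => v hv; rewrite -mulmxA mulmxBl mul1mx vertical_proj_horizontal//
    subr0.
  by rewrite mulmx_suml; apply: eq_bigr => i _; rewrite -scalemxAl.
exists (A *m vertical_proj); first exact: block_skew_so_V.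
by rewrite -mulmxDl subrK -mulmxDr subrK mulmx1.
Qed.

End Stabilizer.

(** * The holonomy algebra *)

Section HolonomyAlgebra.
Variables (R : realType) (m : nat) (M : manifold R m).

Lemma is_derive_met_orbit (B : endfield M) p (e : R -> 'M[R]_m) (A : 'M[R]_m)
    (u w : tangent p) : e 0 = 1%:M ->
  (forall i j, is_derive (0 : R) (1 : R) (fun t => e t i j) (A i j)) ->
  is_derive (0 : R) (1 : R) (fun t => met B p (e t *m u) (e t *m w))
    (met B p (A *m u) w + met B p u (A *m w)).
Proof.
move=> e0 de.
have metE (x y : 'cV[R]_m) : met B p x y = \sum_j \sum_l x j 0 * y l 0 * B p j
  l.
  rewrite /met mxE exchange_big/=; apply: eq_bigr => l _.
  rewrite mxE mulr_suml; apply: eq_bigr => j _.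
  by rewrite !mxE mulrAC.
have dx (x : 'cV[R]_m) j :
    is_derive (0 : R) (1 : R) (fun t => (e t *m x) j 0) ((A *m x) j 0).
  have -> : (fun t => (e t *m x) j 0) = fun t => \sum_k e t j k * x k 0.
    by apply/funext => t; rewrite mxE.
  rewrite mxE; apply: is_derive_sum_pointwise => k.
  apply: is_derive_eq (is_derive_mul (de j k) (is_derive_cst (x k 0) (0 : R)
    (1 : R))) _.
  by rewrite mulr0 addr0.
have := is_derive_trilinear (dx u) (dx w) (fun j l =>
  is_derive_cst (B p j l) (0 : R) (1 : R)).
have -> : (fun t => met B p (e t *m u) (e t *m w)) = (fun t => \sum_j \sum_l
    (e t *m u) j 0 * (e t *m w) l 0 * cst (B p j l) t).
  by apply/funext => t; rewrite metE.
move=> h; apply: is_derive_eq h _.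
rewrite e0 !mul1mx !metE -big_split; apply: eq_bigr => j _.
rewrite -big_split; apply: eq_bigr => l _ /=.
by rewrite mulr0 addr0 mulrDl.
Qed.

Lemma is_derive_cst_eq0 (f : R -> R) (a t l : R) :
  (forall s, f s = a) -> is_derive t 1 f l -> l = 0.
Proof.
move=> fa [_ <-]; have -> : f = cst a by exact/funext.
exact: derive_cst.
Qed.

Variables (phi : 'I_3 -> endfield M) (xi : 'I_3 -> vfield M)
  (eta : 'I_3 -> covfield M) (g : endfield M).
Variables (beta : M -> R) (D : connection M).
Hypothesis acm3 : almost_3contact_metric phi xi eta g.
Hypothesis can_nabla : canonical_connection phi eta g beta D.

(** A one-parameter subgroup of the holonomy group preserves the three tensors; differentiating each
    invariance at time 0 gives a hypothesis of [stabilizer_sub]. *)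
Lemma holonomy_algebra_sub p :
  holonomy_algebra D p `<=` sp_n_sp_1_so_V phi xi eta g p.
Proof.
move=> A [e [eD hol dA]].
have inv_g t := transport_parallel_bilinear (smooth_metric acm3)
  (metric_nabla can_nabla) (hol t).
have inv_v t := transport_parallel_bilinear (smooth_vertical_mx acm3)
  (vertical_nabla acm3 can_nabla) (hol t).
have inv_F t := transport_rotating_bilinears (smooth_fundamental_mx acm3)
  (fundamental_nabla acm3 can_nabla) (hol t).
(* The law of [e] makes [e 0] idempotent, and it preserves [g]; an idempotent isometry fixes every
   vector. *)
have e0 : e 0 = 1%:M.
  have ee : e 0 *m e 0 = e 0 by rewrite -eD addr0.
  have inj (u : 'cV[R]_m) : e 0 *m u = u.
    apply/eqP; rewrite -subr_eq0; apply/eqP/(met_eq0 (acm3.1 0) (p := p)).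
    by rewrite -(inv_g 0) mulmxBr mulmxA ee subrr met0l.
  apply/matrixP => i j; have := inj (delta_mx j 0).
  by rewrite -colE => /matrixP/(_ i 0); rewrite !mxE eqxx andbT.
have d B u w := is_derive_met_orbit (p := p) B u w e0 dA.
apply: (stabilizer_sub acm3).
- move=> u v; apply/eqP; rewrite -addr_eq0; apply/eqP.
  exact: (is_derive_cst_eq0 (fun t => inv_g t u v) (d g u v)).
- move=> u v; rewrite big_split/= -!met_vertical_mx.
  exact: (is_derive_cst_eq0 (fun t => inv_v t u v) (d _ u v)).
- move=> u w u' w' F.
  have dF i := is_derive_mul (d (fundamental_mx phi g i) u w)
                             (d (fundamental_mx phi g i) u' w').
  have := is_derive_cst_eq0 (fun t => inv_F t u w u' w')
    (is_derive_sum_pointwise dF).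
  apply: etrans; apply: eq_bigr => i _.
  by rewrite !met_fundamental_mx e0 !mul1mx.
Qed.

End HolonomyAlgebra.

Theorem corollary4p1p1 (R : realType) (n : nat) (n_ge1 : (1 <= n)%N)
    (M : manifold R (4 * n).+3)
    (phi : 'I_3 -> endfield M) (xi : 'I_3 -> vfield M)
    (eta : 'I_3 -> covfield M) (g : endfield M)
    (beta : M -> R) (nabla : connection M)
    (acm3 : almost_3contact_metric phi xi eta g)
    (can : canonical_acm3 phi xi eta g beta)
    (can_nabla : canonical_connection phi eta g beta nabla) :
  [/\ preserves_upsilon phi nabla,
      parallel_form nabla (Psi phi g),
      parallel_form nabla (eta123 eta)
    & forall p : M,
        holonomy_algebra nabla p `<=` sp_n_sp_1_so_V phi xi eta g p /\
        sp_n_sp_1_so_V phi xi eta g p `<=` so_H_so_V xi eta g p].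
Proof.
split.
- exact: canonical_preserves_upsilon acm3 can_nabla.
- exact: parallel_Psi acm3 can_nabla.
- exact: parallel_eta123 acm3 can_nabla.
- by move=> p; split; [exact: holonomy_algebra_sub can_nabla p
                      |exact: sp_n_sp_1_so_V_sub].
Qed.
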